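(* Let $(n_k)_{k\ge1}\subset\mathbb N$ be an increasing sequence, and let $\alpha,\beta>0$. Suppose that for every integer $t>1$ there is a set of residues $\Lambda_t\subset\{n_k+t\mathbb Z:k\in\mathbb N\}\subset\mathbb Z_t$ such that $\Lambda_{st}=\Lambda_s\cap\Lambda_t$ whenever $(s,t)=1$, and that there exist sequences $(p_j)_{j\ge1}$, $(q_j)_{j\ge1}$ of integers greater than $1$, all of whose terms are pairwise relatively prime, such that $$\mathbb P(\Lambda_{q_j})\to0,\qquad \inf_j\mathbb P(\Lambda_{p_j})>0,$$ $$\varepsilon_\gamma:=\gamma-\liminf_{j\to\infty}\mathbb P(\Lambda_{q_j}^\gamma)=o(\gamma)\quad\text{as }\gamma\to0^+,$$ such that for all $\gamma>0$ sufficiently small, $$\liminf_{j\to\infty}\frac{\big|\{(u,v)\in\Lambda_{q_j}\times\Lambda_{q_j}:\ |u-v-w|>\gamma s_{q_j}\ \ \forall w\in\Lambda_{q_j}\}\big|}{|\Lambda_{q_j}|^2}>5\alpha,$$ and such that for all $Q=p_{i_1}\cdots p_{i_k}q_{j_1}\cdots q_{j_l}$ with $i_1<\dots<i_k$ and $j_1<\dots<j_l$, $$\liminf_{N\to\infty}\frac1N\big|\{1\le k\le N:\ n_k\equiv a \bmod Q\}\big|>\frac{\beta}{|\Lambda_Q|}\qquad\forall a\in\Lambda_Q .$$ Then, given any $C>0$ and any infinite set $\mathcal S\subset\mathbb N$ of positive integers, there exist a probability space $(X,\mathcal F,\mu)$, a measure-preserving transformation $\tau$ on $X$, and an $f\in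 L^1(X)$ such that $$\Big\|\sup_{N\in\mathcal S}\Big|\frac1N\sum_{k=1}^N f\circ\tau^{n_k}\Big|\Big\|_{1,\infty}>C\|f\|_1 .$$
   Context: $\mathbb Z_t=\mathbb Z/t\mathbb Z$. A subset of $\mathbb Z_t$ is identified with the corresponding $t$-periodic subset of $\mathbb Z$, and hence with a subset of $\mathbb Z_{nt}$ for each $n\ge1$; the equality $\Lambda_{st}=\Lambda_s\cap\Lambda_t$ is understood in this sense. For $\Lambda\subset\mathbb Z_t$, $\mathbb P(\Lambda)=|\Lambda|/t$ (unchanged if $\Lambda$ is viewed in $\mathbb Z_{nt}$). For a nonempty set $\Lambda=\Lambda_t$, $s_t:=\mathbb P(\Lambda_t)^{-1}$, and for $\gamma>0$, $\Lambda_t^\gamma:=\Lambda_t+(0,\gamma s_t)\subset\mathbb Z_t$, i.e. the set of residues $\lambda+r \bmod t$ with $\lambda\in\Lambda_t$ and $r$ an integer with $0<r<\gamma s_t$. $|\Lambda_t|$ is the number of elements of $\Lambda_t$ in $\mathbb Z_t$; the sets $\Lambda_{q_j}$ are nonempty. For $z\in\mathbb Z_t$, $|z|$ denotes the distance from $z$ to $0$ in the cyclic group $\mathbb Z_t$ (the minimum absolute value of an integer representative). In the products $Q$, either $k$ or $l$ (not both) may be $0$. $\|g\|_{1,\infty}=\sup_{\lambda>0}\lambda\,\mu(\{|g|>\lambda\})$. *)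

(* Defs.v *)
From mathcomp Require Export all_boot all_order all_algebra.
From mathcomp Require Export all_classical all_reals all_analysis.

Set Implicit Arguments.
Unset Strict Implicit.
Unset Printing Implicit Defensive.

Export Order.TTheory GRing.Theory Num.Theory.
Export numFieldNormedType.Exports.

Local Open Scope classical_set_scope.
Local Open Scope ring_scope.

(* Sets of residues modulo t are finite sets {set 'Z_t}; this type is Z/tZ only
   for 1 < t, so every statement about them has to assume 1 < t. *)

Definition periodic (t : nat) (A : {set 'Z_t}) : set int :=
  [set z : int | z%:~R \in A].

Definition density (R : realType) (t : nat) (A : {set 'Z_t}) : R :=
  #|A|%:R / t%:R.

(* s_t; it is meaningful only for A nonempty, as 0^-1 = 0. *)
Definition spacing (R : realType) (t : nat) (A : {set 'Z_t}) : R :=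
  (density R A)^-1.

(* A + (0, g s_t). The shift r need not be smaller than t, so its range is not
   bounded a priori, hence the classical comprehension. *)
Definition thicken (R : realType) (t : nat) (g : R) (A : {set 'Z_t}) :
    {set 'Z_t} :=
  [set x : 'Z_t | `[< exists l : 'Z_t, exists r : nat,
     [/\ l \in A, (0 < r)%N, r%:R < g * spacing R A & x = l + r%:R] >]]%SET.

Definition cyc_abs (t : nat) (z : 'Z_t) : nat := minn z (t - z).

Lemma cyc_abs_min (t : nat) (z : 'Z_t) : (1 < t)%N ->
  (forall m : int, m%:~R = z -> (cyc_abs z <= `|m|)%N) /\
  (exists2 m : int, m%:~R = z & `|m|%N = cyc_abs z).
Proof.
move=> t1; have zt : (z < t)%N by rewrite -[X in (_ < X)%N](Zp_cast t1).
have tz : t%:R = 0 :> 'Z_t by rewrite pchar_Zp.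
split.
  case=> m /=; rewrite ?NegzE ?mulrNz -!pmulrn => mz.
    have zm : (z : nat) = (m %% t)%N by rewrite -mz val_Zp_nat.
    by rewrite /cyc_abs (leq_trans (geq_minl _ _))// zm leq_mod.
  have : (z : nat) + m.+1 = 0 %[mod t].
    rewrite -[in RHS](mod0n t) modn_mod -!(val_Zp_nat t1) natrD.
    by rewrite natr_Zp -mz addNr.
  rewrite mod0n => /eqP dv.
  have {}dv : (t %| z + m.+1)%N by [].
  rewrite (leq_trans (geq_minr _ _))// leq_subLR.
  by apply: dvdn_leq => //; rewrite addnS.
case: (leqP z (t - z)) => [le|/ltnW le].
  exists (z : nat)%:Z; first by rewrite -pmulrn natr_Zp.
  by rewrite /cyc_abs; move/minn_idPl: le => ->.
exists (- (t - z)%N%:Z).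
  by rewrite mulrNz -pmulrn natrB ?(ltnW zt)// tz sub0r opprK natr_Zp.
by rewrite abszN /cyc_abs; move/minn_idPr: le => ->.
Qed.

Definition far_pairs (R : realType) (t : nat) (g : R) (A : {set 'Z_t}) :
    {set 'Z_t * 'Z_t} :=
  [set uv in finset.setX A A |
    [forall w in A, g * spacing R A < (cyc_abs (uv.1 - uv.2 - w))%:R]]%SET.

Definition measure_preserving (R : realType) (d : measure_display)
    (X : measurableType d) (mu : set X -> \bar R) (tau : X -> X) : Prop :=
  measurable_fun setT tau /\
  forall A : set X, measurable A -> mu (tau @^-1` A) = mu A.

Definition weak_norm1 (R : realType) (d : measure_display)
    (X : measurableType d) (mu : set X -> \bar R) (g : X -> \bar R) : \bar R :=
  ereal_sup [set (l%:E * mu [set x | l%:E < `|g x|])%E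
            | l in [set l : R | 0 < l]].

(* Sequences are indexed from 0: n k stands for the (k+1)-st term, so the
   average over the first N terms runs over k < N. *)
Definition average_along (R : realType) (X : Type) (n : nat -> nat)
    (tau : X -> X) (f : X -> R) (N : nat) (x : X) : R :=
  N%:R^-1 * \sum_(k < N) f (iter (n k) tau x).

Definition maximal_along (R : realType) (X : Type) (n : nat -> nat)
    (S : set nat) (tau : X -> X) (f : X -> R) (x : X) : \bar R :=
  ereal_sup [set `|average_along n tau f N x|%:E | N in S].

(* Main.v *)
Require Import Defs.
From HB Require Import structures.
From mathcomp Require Import ring lra zify.

(* Call a pair (m, r) attainable if there is a periodic f >= 0 of mean m and a
   minorant beta * X of its maximal function such that exp (- X) has mean at
   most r. Constants give (m, 1), and the theorem follows once (m, exp (- K m))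
   is attainable with K and m large, by Chebyshev's inequality for exp (- X).

   Two pairs are combined as follows. Take first a function f2 for (m2, r2),
   and then q = q_j so sparse that the set E = - Lambda_q^gamma, of density
   about gamma, consists of intervals much longer than the averages used for
   f2. Keep f2 off E only, so that outside E nothing changes. Then take f1 for
   (m1, r1), using only averages so long that n_k is equidistributed modulo
   everything chosen before, and concentrate f1 on the residues -r mod q with
   0 < r < gamma s_q: every point of E still sees all of f1 along a residue
   class of Lambda_q. By the far pairs hypothesis a proportion 4 alpha of E
   moreover sees the part of f2 off E with density at least alpha, hence gains
   alpha * m2; for this f2 is first translated by random amounts on the blocks
   of a large modulus p_i, so that its averages over Lambda are nearly constant.
   This yields the mean gamma m1 + (1 - gamma) m2, and
   gamma r1 (1 - 4 alpha (1 - exp (- alpha m2))) + (1 - gamma) r2 for r.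

   Starting from (m + 1, r) and applying this M / gamma times with (m1, r1) =
   (m, r) brings the mean to m + d with d = (1 - gamma)^(M / gamma) and
   multiplies r by about 1 - 2 alpha^2 M d. As M is arbitrary, every round
   gains a factor exp (- K d) for an increase d of the mean, for any K. *)

Set Implicit Arguments.
Unset Strict Implicit.
Unset Printing Implicit Defensive.

Local Open Scope classical_set_scope.
Local Open Scope ring_scope.

(** * Averages of periodic functions *)

Section PeriodicAverages.

Variable R : realType.

Definition has_period (V : Type) (t : nat) (f : nat -> V) :=
  forall x, f (x + t)%N = f x.

Lemma has_period_mull (V : Type) s t (f : nat -> V) :
  has_period t f -> has_period (s * t)%N f.
Proof.
move=> ft x; elim: s => [|s IH]; first by rewrite mul0n addn0.
by rewrite mulSn addnCA addnC ft IH.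
Qed.

Lemma has_period_mulr (V : Type) s t (f : nat -> V) :
  has_period s f -> has_period (s * t)%N f.
Proof. by rewrite mulnC; exact: has_period_mull. Qed.

Lemma has_period_mod (V : Type) t (f : nat -> V) x :
  has_period t f -> f (x %% t)%N = f x.
Proof.
by move=> ft; rewrite [in RHS](divn_eq x t) addnC (has_period_mull _ ft).
Qed.

Lemma has_period_modD (V : Type) t (f : nat -> V) x y :
  has_period t f -> f (x + y %% t)%N = f (x + y)%N.
Proof.
by move=> ft; rewrite -(has_period_mod _ ft) modnDmr (has_period_mod _ ft).
Qed.

Definition avg (t : nat) (f : nat -> R) : R := t%:R^-1 * \sum_(x < t) f x.

Lemma eq_avg t f g : (forall x, (x < t)%N -> f x = g x) -> avg t f = avg t g.
Proof. by move=> fg; congr (_ * _); apply: eq_bigr => x _; exact: fg. Qed.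

Lemma le_avg t f g : (forall x, (x < t)%N -> f x <= g x) -> avg t f <= avg t g.
Proof.
move=> fg; rewrite /avg ler_wpM2l ?invr_ge0 ?ler0n//.
by apply: ler_sum => x _; exact: fg.
Qed.

Lemma avg_ge0 t f : (forall x, 0 <= f x) -> 0 <= avg t f.
Proof. by move=> f0; rewrite mulr_ge0 ?invr_ge0 ?ler0n// sumr_ge0. Qed.

Lemma avgD t f g : avg t (fun x => f x + g x) = avg t f + avg t g.
Proof. by rewrite /avg big_split/= mulrDr. Qed.

Lemma avgZ t c f : avg t (fun x => c * f x) = c * avg t f.
Proof. by rewrite /avg -mulr_sumr mulrCA. Qed.

Lemma avg_sum t m (F : nat -> nat -> R) :
  avg t (fun x => \sum_(i < m) F i x) = \sum_(i < m) avg t (F i).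
Proof. by rewrite /avg exchange_big/= mulr_sumr. Qed.

Lemma avg_cst t c : (0 < t)%N -> avg t (fun=> c) = c.
Proof.
move=> t0; rewrite /avg sumr_const card_ord -[c *+ t]mulr_natl mulKf//.
by rewrite pnatr_eq0 -lt0n.
Qed.

Lemma avg_le_mass t f x : has_period t f -> (0 < t)%N ->
  (forall x, 0 <= f x) -> f x <= t%:R * avg t f.
Proof.
move=> ft t0 f0; rewrite /avg mulVKf ?pnatr_eq0 -?lt0n//.
rewrite -(has_period_mod _ ft) (bigD1 (Ordinal (ltn_pmod x t0)))//=.
by rewrite lerDl sumr_ge0.
Qed.

Lemma avg_shift t f a : has_period t f ->
  avg t (fun x => f (x + a)%N) = avg t f.
Proof.
case: t => [|t] ft; first by rewrite /avg !big_ord0.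
elim: a => [|a IH]; first by apply: eq_avg => x _; rewrite addn0.
rewrite -{}IH /avg; congr (_ * _).
rewrite big_ord_recr big_ord_recl/= addrC; congr (_ + _).
  by rewrite add0n addnS -addSn addnC ft.
by apply: eq_bigr => i _; rewrite /bump/= add1n addnS addSn.
Qed.

(** Chinese remainder theorem as a reindexing: c is sent to its pair of residues, which is injective
    between finite sets of equal size. *)
Lemma sum_crt s t (Phi : nat -> nat -> R) : coprime s t ->
  \sum_(c < s * t) Phi (c %% s)%N (c %% t)%N =
  \sum_(u < s) \sum_(v < t) Phi u v.
Proof.
have [->|s0] := posnP s; first by rewrite !big_ord0.
have [->|t0] := posnP t.
  by move=> _; rewrite muln0 big_ord0 big1// => i _; rewrite big_ord0.
move=> co; rewrite pair_big/=.
pose h (c : 'I_(s * t)) : 'I_s * 'I_t :=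
  (Ordinal (ltn_pmod c s0), Ordinal (ltn_pmod c t0)).
have hinj : injective h.
  move=> c d [] e1 e2; apply/val_inj/eqP => /=.
  rewrite -(modn_small (ltn_ord c)) -(modn_small (ltn_ord d)).
  by rewrite chinese_remainder// e1 e2 !eqxx.
have hbij : bijective h.
  by apply: inj_card_bij => //; rewrite card_prod !card_ord.
rewrite [RHS](reindex h)//=.
exact: onW_bij.
Qed.

Lemma avg_crt s t (Phi : nat -> nat -> R) : coprime s t ->
  avg (s * t) (fun c => Phi (c %% s)%N (c %% t)%N) =
  avg s (fun u => avg t (Phi u)).
Proof.
by move=> co; rewrite /avg sum_crt// natrM invfM -mulrA; congr (_ * _);
   rewrite mulr_sumr.
Qed.

(** Functions with coprime periods are independent; this is how the factors built from different
    moduli are separated later. *)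
Lemma avgM s t f g : coprime s t -> has_period s f -> has_period t g ->
  avg (s * t) (fun x => f x * g x) = avg s f * avg t g.
Proof.
move=> co fs gt.
rewrite -(@eq_avg _ (fun c => f (c %% s)%N * g (c %% t)%N)); last first.
  by move=> x _; rewrite (has_period_mod _ fs) (has_period_mod _ gt).
rewrite (avg_crt (fun u v => f u * g v))//.
under eq_avg do rewrite avgZ.
by rewrite /avg -mulr_suml mulrA.
Qed.

Lemma avg_widen s t f : (0 < s)%N -> (0 < t)%N -> has_period s f ->
  avg (s * t) f = avg s f.
Proof.
move=> s0 t0 fs; elim: t t0 => // -[|t] IH _; first by rewrite muln1.
have sE u : \sum_(x < s * u) f x = u%:R * \sum_(x < s) f x.
  elim: u => [|u IHu]; first by rewrite muln0 big_ord0 mul0r.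
  rewrite mulnS big_split_ord/= mulrS mulrDl mul1r; congr (_ + _).
  by rewrite -IHu; apply: eq_bigr => i _; rewrite addnC fs.
rewrite /avg sE natrM invfM -mulrA [X in _ * X]mulrA mulVf ?mul1r//.
Qed.

Lemma avg_dvd s t f : (s %| t)%N -> (0 < t)%N -> has_period s f ->
  avg t f = avg s f.
Proof.
move=> /dvdnP[k ->]; rewrite muln_gt0 mulnC => /andP[k0 s0] fs.
exact: avg_widen.
Qed.

Lemma avg_exchange s t (Phi : nat -> nat -> R) :
  avg s (fun x => avg t (Phi x)) = avg t (fun y => avg s (Phi^~ y)).
Proof.
rewrite /avg; under eq_bigr do rewrite mulr_sumr.
under [in RHS]eq_bigr do rewrite mulr_sumr.
rewrite exchange_big/= mulr_sumr [RHS]mulr_sumr; apply: eq_bigr => y _.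
by rewrite !mulr_sumr; apply: eq_bigr => x _; rewrite mulrCA.
Qed.

End PeriodicAverages.

(** * Random translations on blocks *)

Section RandomShifts.
Variable R : realType.

Lemma sum_range_le a b N :
  (\sum_(i < N) (a <= i < a + b) <= b)%N.
Proof.
suff -> : (\sum_(i < N) (a <= i < a + b) = minn N (a + b) - minn N a)%N by lia.
elim: N => [|N IH]; first by rewrite big_ord0 !min0n.
by rewrite big_ord_recr/= IH; lia.
Qed.

(** The rotation by x does not affect a sum over a full period N, and without it the indices of
    block k lie in an interval of length B. *)
Lemma sum_block_le N B k x : (0 < B)%N ->
  \sum_(i < N) (((x + i) %% N) %/ B == k)%N%:R <= B%:R :> R.
Proof.
move=> B0; have [->|N0] := posnP N; first by rewrite big_ord0.
pose f y : R := ((y %% N) %/ B == k)%N%:R.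
have fN : has_period N f by move=> y; rewrite /f modnDr.
have := avg_shift x fN; rewrite /avg.
have NE : N%:R^-1 != 0 :> R by rewrite invr_eq0 pnatr_eq0 -lt0n.
move=> /(mulfI NE) e.
under eq_bigr do rewrite addnC.
rewrite {}e -natr_sum ler_nat.
apply: leq_trans (sum_range_le (k * B) B N); apply: leq_sum => i _.
rewrite modn_small//; case: eqP => // <-.
by rewrite leq_divM -mulSnr ltn_ceil.
Qed.

(* Distinct blocks are translated independently. *)
Lemma sum_ffun_pair m T (h : nat -> R) (i j : 'I_m) : i != j ->
  \sum_(s < T) h s = 0 ->
  \sum_(f : {ffun 'I_m -> 'I_T}) h (f i) * h (f j) = 0.
Proof.
move=> ij h0.
pose F (k : 'I_m) (s : 'I_T) := (if k \in [:: i; j] then h s else 1).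
transitivity (\sum_(f : {ffun 'I_m -> 'I_T}) \prod_k F k (f k)).
  apply: eq_bigr => f _; rewrite (bigD1 i)//= (bigD1 j)/= 1?eq_sym// /F.
  rewrite !inE !eqxx orbT/= big1 ?mulr1// => k /andP[ki kj].
  by rewrite !inE (negbTE ki) (negbTE kj).
rewrite -bigA_distr_bigA (bigD1 i)//= /F mem_head h0 mul0r//.
Qed.

Variables (p B T : nat) (w g : nat -> R) (mu G W : R).
Hypotheses (p_gt0 : (0 < p)%N) (B_gt0 : (0 < B)%N) (T_gt0 : (0 < T)%N).
Hypotheses (w_ge0 : forall b, 0 <= w b) (w_le : forall b, w b <= W).
Hypothesis avg_w : avg p w = 1.
Hypotheses (g_period : has_period T g) (avg_g : avg T g = mu).
Hypothesis g_dev : forall x, `|g x - mu| <= G.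

(** A weighted average of translates of [g] in which x + b, reduced mod p, is moved by the amount
    [s] attached to its block of length B. *)
Definition shifted_avg (s : nat -> nat) (x : nat) : R :=
  avg p (fun b => w b * g (x + s ((x + b) %% p %/ B))%N).

Lemma shifted_avg_dev s x : shifted_avg s x - mu =
  avg p (fun b => w b * (g (x + s ((x + b) %% p %/ B))%N - mu)).
Proof.
rewrite -[X in _ - X]mul1r -avg_w [X in _ - X]mulrC -avgZ -mulN1r -avgZ -avgD.
by apply: eq_avg => b _; ring.
Qed.

Let sh (f : {ffun 'I_p.+1 -> 'I_T}) (k : nat) : nat := f (inord k).

(** Second moment over all choices of translations. In the expanded square, pairs b, b' in distinct
    blocks cancel because [g - mu] has mean 0; each b leaves at most B partners b' in its own block,
    each of weight at most W. *)
Lemma shifted_avg_variance x :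
  \sum_f (shifted_avg (sh f) x - mu) ^+ 2 <=
  #|{ffun 'I_p.+1 -> 'I_T}|%:R * (G ^+ 2 * (W * B%:R / p%:R)).
Proof.
pose F := {ffun 'I_p.+1 -> 'I_T}.
pose blk b := ((x + b) %% p %/ B)%N.
pose h s := g (x + s)%N - mu.
have pE : p%:R != 0 :> R by rewrite pnatr_eq0 -lt0n.
have TE : T%:R != 0 :> R by rewrite pnatr_eq0 -lt0n.
have h0 : \sum_(s < T) h s = 0.
  have : avg T h = 0.
    have -> : avg T h = avg T (fun s => g (s + x)%N) + avg T (fun=> - mu).
      by rewrite -avgD; apply: eq_avg => s _; rewrite /h addnC.
    by rewrite avg_shift// avg_g avg_cst// subrr.
  by move=> /eqP; rewrite mulf_eq0 invr_eq0 (negbTE TE) => /eqP.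
have hG s t : h s * h t <= G ^+ 2.
  apply: le_trans (ler_norm _) _; rewrite normrM expr2.
  by rewrite ler_pM// /h.
have blkp b : (blk b < p.+1)%N.
  by rewrite ltnS (leq_trans (leq_div _ _))// ltnW// ltn_pmod.
have corr b b' : \sum_(f : F) h (sh f (blk b)) * h (sh f (blk b')) <=
    #|F|%:R * G ^+ 2 * (blk b' == blk b)%:R.
  have [e|ne] := eqVneq (blk b') (blk b).
    rewrite e mulr1 mulr_natl -sumr_const; apply: ler_sum => f _.
    exact: hG.
  rewrite mulr0 sum_ffun_pair//; apply: contra_neq ne => /(congr1 val)/=.
  by rewrite !inordK// => ->.
have sqE (f : F) : (shifted_avg (sh f) x - mu) ^+ 2 =
    p%:R^-1 ^+ 2 * \sum_(b < p) \sum_(b' < p)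
      w b * w b' * (h (sh f (blk b)) * h (sh f (blk b'))).
  rewrite shifted_avg_dev /avg exprMn; congr (_ * _).
  rewrite expr2 mulr_suml; apply: eq_bigr => b _.
  by rewrite mulr_sumr; apply: eq_bigr => b' _; rewrite mulrACA.
under eq_bigr do rewrite sqE.
rewrite -mulr_sumr exchange_big/=.
under eq_bigr do rewrite exchange_big/=.
have W0 : 0 <= W by exact: le_trans (w_ge0 0) (w_le 0).
have G0 : 0 <= G by exact: le_trans (normr_ge0 _) (g_dev 0).
have step : \sum_(b < p) \sum_(b' < p) \sum_(f : F)
    w b * w b' * (h (sh f (blk b)) * h (sh f (blk b'))) <=
    \sum_(b < p) w b * (#|F|%:R * G ^+ 2 * (W * B%:R)).
  apply: ler_sum => b _.
  apply: (@le_trans _ _ (\sum_(b' < p)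
      w b * (#|F|%:R * G ^+ 2 * (W * (blk b' == blk b)%:R)))).
    apply: ler_sum => b' _; rewrite -mulr_sumr -mulrA ler_wpM2l//.
    apply: le_trans (ler_wpM2l (w_ge0 b') (corr b b')) _.
    rewrite mulrCA ler_wpM2l ?mulr_ge0 ?sqr_ge0//.
 by rewrite ler_wpM2r.
  rewrite -mulr_sumr -mulr_sumr -mulr_sumr.
  rewrite ler_wpM2l// ler_wpM2l ?mulr_ge0 ?sqr_ge0// ler_wpM2l//.
  exact: sum_block_le.
apply: le_trans (ler_wpM2l _ step) _; first by rewrite sqr_ge0.
rewrite -mulr_suml.
have -> : \sum_(b < p) w b = p%:R.
  by move: avg_w; rewrite /avg => /(congr1 ( *%R p%:R)); rewrite mulVKf// mulr1.
rewrite le_eqVlt; apply/orP; left; apply/eqP; field.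
exact: pE.
Qed.

(** Some choice of translations does at least as well as the mean over all of them. *)
Lemma exists_shift N : (0 < N)%N -> exists s : nat -> nat,
  avg N (fun x => (shifted_avg s x - mu) ^+ 2) <= G ^+ 2 * (W * B%:R / p%:R).
Proof.
move=> N0; set c := G ^+ 2 * _; pose F := {ffun 'I_p.+1 -> 'I_T}.
pose u (f : F) := avg N (fun x => (shifted_avg (sh f) x - mu) ^+ 2).
have [[f uf]|no] := pselect (exists f : F, u f <= c); first by exists (sh f).
have F0 : (0 < #|F|)%N by rewrite card_ffun !card_ord expn_gt0 T_gt0.
have : \sum_(f : F) u f <= #|F|%:R * c.
  have -> : \sum_(f : F) u f =
      avg N (fun x => \sum_(f : F) (shifted_avg (sh f) x - mu) ^+ 2).
    by rewrite /u /avg -mulr_sumr exchange_big.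
  rewrite -[leRHS](@avg_cst _ N)//; apply: le_avg => x _.
  exact: shifted_avg_variance.
rewrite leNgt => /negP[]; rewrite mulr_natl -sumr_const.
have /card_gt0P[f0 _] := F0; apply: ltr_sum => [|f _].
  by apply/hasP; exists f0; [exact: mem_index_enum|].
by rewrite ltNge; apply/negP => uf; apply: no; exists f.
Qed.

(** Chebyshev's inequality applied to the second moment. *)
Lemma exists_good_shift N e : (0 < N)%N -> 0 < e ->
  G ^+ 2 * (W * B%:R / p%:R) <= e ^+ 3 -> exists s : nat -> nat,
  avg N (fun x => (shifted_avg s x < mu - e)%R%:R) <= e.
Proof.
move=> N0 e0 He; have [s sP] := exists_shift N0; exists s.
rewrite -(ler_pM2l (exprn_gt0 2 e0)) -exprSr -avgZ.
apply: le_trans He; apply: le_trans sP; apply: le_avg => x _.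
case: ltP => h; last by rewrite mulr0 sqr_ge0.
by rewrite mulr1; nra.
Qed.

End RandomShifts.

(** The bounds on [u] ensure that the real-valued infima, suprema and limit in [limn_inf] are
    genuine and not default values. *)
Lemma limn_inf_gt (R : realType) (u : nat -> R) (a b c : R) :
  (forall k, a <= u k <= b) -> c < limn_inf u ->
  exists K, forall k, (K <= k)%N -> c < u k.
Proof.
move=> uab cu.
have lbu : has_lbound (range u).
  by exists a => _ [k _ <-]; case/andP: (uab k).
have ubu : has_ubound (range u).
  by exists b => _ [k _ <-]; case/andP: (uab k).
have iE : limn_inf u = sup (range (infs u)).
  by apply/cvg_lim => //; exact: cvg_infs_sup.
have ne : range (infs u) !=set0 by exists (infs u 0%N); exists 0%N.
rewrite iE in cu; have [y [K _ <-] cK] := sup_gt ne cu.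
exists K => k Kk; apply: lt_le_trans cK _.
apply: ge_inf; first exact: has_lbound_sdrop.
by exists k.
Qed.

(** * The residue sets Lambda_t *)

Section Residues.
Variables (R : realType) (Lam : forall t : nat, {set 'Z_t}).
Hypothesis Lam_coprime : forall s t : nat, (1 < s)%N -> (1 < t)%N ->
  coprime s t ->
  periodic (Lam (s * t)%N) = periodic (Lam s) `&` periodic (Lam t).

Definition res (t x : nat) : bool := (x%:R : 'Z_t) \in Lam t.

Lemma res_period t : (1 < t)%N -> has_period t (res t).
Proof. by move=> t1 x; rewrite /res natrD pchar_Zp// addr0. Qed.

Lemma res_mul s t x : (1 < s)%N -> (1 < t)%N -> coprime s t ->
  res (s * t) x = res s x && res t x.
Proof.
move=> s1 t1 co; have /seteqP[st ts] := Lam_coprime s1 t1 co.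
apply/idP/andP => [h|[h1 h2]].
  by have := st x%:Z; rewrite /periodic/= -!pmulrn; apply.
by have := ts x%:Z; rewrite /periodic/= -!pmulrn; apply; split.
Qed.

Lemma sum_Zp (V : nmodType) t (F : nat -> V) : (1 < t)%N ->
  \sum_(x : 'Z_t) F x = \sum_(x < t) F x.
Proof.
by move=> t1; rewrite -(big_mkord xpredT F) -(big_mkord xpredT F) Zp_cast.
Qed.

Lemma natr_Zp_eq t x y : (1 < t)%N ->
  ((x%:R : 'Z_t) == y%:R) = (x == y %[mod t]).
Proof. by move=> t1; rewrite -val_eqE/= !val_Zp_nat. Qed.

Lemma card_Zp_pred t (A : {set 'Z_t}) : (1 < t)%N ->
  (#|A|%:R = \sum_(x < t) ((x%:R : 'Z_t) \in A)%:R :> R).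
Proof.
move=> t1; rewrite -(sum_Zp (fun x => ((x%:R : 'Z_t) \in A)%:R))//.
rewrite -sum1_card natr_sum big_mkcond/=; apply: eq_bigr => x _.
by rewrite natr_Zp; case: ifP.
Qed.

Lemma avg_res t : (1 < t)%N ->
  avg t (fun x => (res t x)%:R) = density R (Lam t).
Proof. by move=> t1; rewrite /avg /density card_Zp_pred// mulrC. Qed.

Lemma density_mul s t : (1 < s)%N -> (1 < t)%N -> coprime s t ->
  density R (Lam (s * t)) = density R (Lam s) * density R (Lam t).
Proof.
move=> s1 t1 co; have st1 : (1 < s * t)%N by lia.
rewrite -!avg_res// -avgM//; last 2 first.
- by move=> x; rewrite res_period.
- by move=> x; rewrite res_period.
by apply: eq_avg => x _; rewrite res_mul// -mulnb natrM.
Qed.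

(* The indicator of Lambda_t normalized to have mean 1, which makes it
   multiplicative over coprime moduli. *)
Definition wgt (t x : nat) : R := (res t x)%:R / density R (Lam t).

Lemma density_ge0 t (A : {set 'Z_t}) : 0 <= density R A.
Proof. by rewrite divr_ge0. Qed.

Lemma density_le1 t (A : {set 'Z_t}) : (1 < t)%N -> density R A <= 1.
Proof.
move=> t1; rewrite ler_pdivrMr ?ltr0n 1?ltnW// mul1r ler_nat.
by rewrite (leq_trans (max_card _))// card_ord Zp_cast.
Qed.

Lemma card_density t : (1 < t)%N -> #|Lam t|%:R = t%:R * density R (Lam t).
Proof.
by move=> t1; rewrite /density mulrCA divff ?mulr1// pnatr_eq0 -lt0n ltnW.
Qed.

Lemma wgt_ge0 t x : 0 <= wgt t x.
Proof. by rewrite divr_ge0 ?density_ge0. Qed.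

Lemma wgt_period t : (1 < t)%N -> has_period t (wgt t).
Proof. by move=> t1 x; rewrite /wgt res_period. Qed.

Lemma avg_wgt t : (1 < t)%N -> 0 < density R (Lam t) -> avg t (wgt t) = 1.
Proof.
move=> t1 d0; rewrite /wgt.
under eq_avg do rewrite mulrC.
by rewrite avgZ avg_res// mulVf// gt_eqF.
Qed.

Lemma wgt_mul s t x : (1 < s)%N -> (1 < t)%N -> coprime s t ->
  wgt (s * t) x = wgt s x * wgt t x.
Proof.
move=> s1 t1 co; rewrite /wgt res_mul// density_mul// -mulnb natrM invfM.
by rewrite mulrACA.
Qed.

End Residues.

(** * The set - Lambda_t^gamma *)

Section Thickening.
Variables (R : realType) (Lam : forall t : nat, {set 'Z_t}).
Variables (t : nat) (g alpha : R).
Hypotheses (t_gt1 : (1 < t)%N) (g_gt0 : 0 < g).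
Hypothesis density_gt0 : 0 < density R (Lam t).

Local Notation res := (res Lam).
Local Notation wgt := (wgt R Lam).
Local Notation s := (spacing R (Lam t)).

(* The points congruent to -r for some 0 < r < g s; t - x %% t is the least
   positive such r. *)
Definition slab (x : nat) : bool := (t - x %% t)%N%:R < g * s.

(* The points from which some translate by Lambda_t reaches the slab, that is,
   the set - Lambda_t^g. *)
Definition visible (x : nat) : bool :=
  [exists l : 'I_t, res t l && slab (x + l)].

Definition outside (x : nat) : R :=
  avg t (fun v => wgt t v * (~~ visible (x + v))%:R).

Lemma slab_period : has_period t slab.
Proof. by move=> x; rewrite /slab modnDr. Qed.

Lemma visible_period : has_period t visible.
Proof.
move=> x; apply: eq_existsb => l; congr (_ && _).
by rewrite addnAC slab_period.
Qed.

Lemma outside_period : has_period t outside.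
Proof.
move=> x; apply: eq_avg => v _; congr (_ * (~~ _)%:R).
by rewrite addnAC visible_period.
Qed.

Lemma outside_ge0 x : 0 <= outside x.
Proof. by apply: avg_ge0 => v; rewrite mulr_ge0 ?wgt_ge0. Qed.

Let t_gt0 : (0 < t)%N. Proof. exact: ltnW. Qed.
Let tE : t%:R != 0 :> R. Proof. by rewrite pnatr_eq0 -lt0n. Qed.

Lemma slab_residue x (l : 'Z_t) r : (0 < r)%N -> r%:R < g * s ->
  x%:R + l + r%:R = 0 -> slab (x + l).
Proof.
move=> r0 rs e; rewrite /slab; apply: le_lt_trans rs; rewrite ler_nat.
have /eqP : (x + l + r)%:R == 0%:R :> 'Z_t by rewrite !natrD natr_Zp e.
move/eqP; rewrite natr_Zp_eq// mod0n => /eqP e'.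
have : (t %| (x + l) %% t + r)%N by rewrite /dvdn modnDml e'.
move=> /dvdn_leq; rewrite addn_gt0 r0 orbT => /(_ isT).
by rewrite leq_subLR.
Qed.

Lemma slabP x : slab x -> exists r, [/\ (0 < r)%N, r%:R < g * s &
  x%:R + r%:R = 0 :> 'Z_t].
Proof.
move=> sx; exists (t - x %% t)%N; split=> //.
  by rewrite subn_gt0 ltn_pmod.
rewrite -(Zp_nat_mod t_gt1 x) -natrD subnKC ?pchar_Zp//.
by rewrite ltnW// ltn_pmod.
Qed.

(** The reflection x -> -x carries the visible points onto [thicken g (Lam t)]. *)
Lemma avg_visible :
  avg t (fun x => (visible x)%:R) = density R (thicken g (Lam t)).
Proof.
rewrite /avg /density mulrC; congr (_ / _).
rewrite (card_Zp_pred R _ t_gt1).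
set T := thicken g (Lam t).
rewrite -[RHS](sum_Zp (fun x => (x%:R \in T)%:R))//.
rewrite [RHS](reindex_inj (@oppr_inj _)).
rewrite -(sum_Zp (fun x => (visible x)%:R : R))//.
apply: eq_bigr => x _; congr (_%:R); congr nat_of_bool.
rewrite natr_Zp inE; apply/existsP/asboolP => [[l /andP[rl sl]]|].
  have [r [r0 rs e]] := slabP sl; exists l%:R, r; split=> //.
  apply/eqP; rewrite -subr_eq0; apply/eqP.
  by rewrite -[RHS]oppr0 -e natrD natr_Zp; ring.
move=> [l [r [lL r0 rs e]]].
have lt : (l < t)%N by rewrite -[X in (_ < X)%N](Zp_cast t_gt1).
exists (Ordinal lt); rewrite /=/res natr_Zp lL /=.
apply: (slab_residue (r := r)) => //.
by rewrite natr_Zp -[x]opprK e; ring.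
Qed.

Lemma le1_sum m (F : 'I_m -> R) i : (forall i, 0 <= F i) -> 1 <= F i ->
  1 <= \sum_(i < m) F i.
Proof.
move=> F0 Fi; rewrite (bigD1 i)//=; apply: (le_trans Fi).
by rewrite lerDl sumr_ge0.
Qed.

(** Modulo t the slab has at most g s elements, and s is the inverse of the density of [Lam t]. *)
Lemma card_avg_slab : #|Lam t|%:R * avg t (fun x => (slab x)%:R) <= g.
Proof.
rewrite card_density//.
have -> : t%:R * density R (Lam t) * avg t (fun x => (slab x)%:R) =
    density R (Lam t) * \sum_(x < t) (slab x)%:R.
  by rewrite /avg; field; exact: tE.
suff h : \sum_(x < t) (slab x)%:R <= g * s.
  apply: le_trans (ler_wpM2l (ltW density_gt0) h) _.
  by rewrite /spacing mulrCA divff ?mulr1// gt_eqF.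
have gs0 : 0 < g * s by rewrite mulr_gt0// invr_gt0.
pose K := Num.truncn (g * s).
have KE : K%:R <= g * s < K.+1%:R by apply: truncn_itv; exact: ltW.
apply: (@le_trans _ _ K%:R); last by case/andP: KE.
rewrite -natr_sum ler_nat.
apply: leq_trans (_ : \sum_(x < t) (t - K <= x < t - K + K) <= _)%N.
  apply: leq_sum => x _; rewrite /slab modn_small//.
  case: ltP => // lt1.
  have : (t - x)%N%:R < K.+1%:R :> R.
    by apply: lt_trans lt1 _; case/andP: KE.
  rewrite ltr_nat ltnS => lt2.
  have xt := ltn_ord x.
  by rewrite lt0b; lia.
exact: sum_range_le.
Qed.


(** Union bound over l; every translate of the slab has the same density. *)
Lemma avg_exists_slab (b : nat -> bool) :
  avg t (fun x => [exists l : 'I_t, b l && slab (x + l)]%:R) <=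
  (\sum_(l < t) (b l)%:R) * avg t (fun x => (slab x)%:R) :> R.
Proof.
rewrite mulr_suml; apply: (@le_trans _ _ (avg t (fun x =>
  \sum_(l < t) (b l)%:R * (slab (x + l))%:R))).
  apply: le_avg => x _; case: existsP => [[l bl]|_]; last exact: sumr_ge0.
  apply: (@le1_sum _ (fun l => (b l)%:R * (slab (x + l))%:R) l) => //.
  by case/andP: bl => -> ->; rewrite mulr1.
rewrite (avg_sum _ _ (fun l x => (b l)%:R * (slab (x + l))%:R)).
apply: ler_sum => l _; rewrite avgZ (@avg_shift _ _ (fun x => (slab x)%:R))//.
by move=> x; rewrite slab_period.
Qed.

Lemma card_res : #|Lam t|%:R = \sum_(l < t) (res t l)%:R :> R.
Proof. exact: card_Zp_pred. Qed.

Lemma avg_visible_le : avg t (fun x => (visible x)%:R) <= g.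
Proof.
apply: le_trans (avg_exists_slab (res t)) _.
by rewrite -card_res; exact: card_avg_slab.
Qed.

(* Modulo t the slab is a single interval, so it is entered only once. *)
Let slab_start_unique x y : slab x.+1 -> ~~ slab x -> slab y.+1 -> ~~ slab y ->
  x = y %[mod t].
Proof.
have bnd z : slab z.+1 -> ~~ slab z -> (t - z %% t).-1%:R < g * s /\
    g * s <= (t - z %% t)%N%:R.
  rewrite /slab -leNgt; have zt : (z %% t < t)%N by rewrite ltn_pmod.
  have [zt'|tz] := ltnP (z %% t).+1 t.
    rewrite -[z.+1]addn1 -modnDml addn1 modn_small// => h1 h2; split=> //.
    by rewrite -subnS.
  have {zt tz}tE' : (z %% t).+1 = t by lia.
  rewrite -[z.+1]addn1 -modnDml addn1 tE' modnn subn0 => h1 h2.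
  have h : (t - z %% t = 1)%N by rewrite -{1}tE' subSnn.
  move: h2; rewrite h => h2; have := lt_le_trans h1 h2.
  by rewrite (ltr_nat _ t 1) ltnNge ltnW.
move=> x1 x0 y1 y0.
have [bx1 bx2] := bnd _ x1 x0; have [by1 by2] := bnd _ y1 y0.
have := lt_le_trans bx1 by2; have := lt_le_trans by1 bx2; rewrite !ltr_nat.
have xt : (x %% t < t)%N by rewrite ltn_pmod.
have yt : (y %% t < t)%N by rewrite ltn_pmod.
clear -xt yt; lia.
Qed.

Lemma avg_slab_start :
  avg t (fun x => (slab x.+1 && ~~ slab x)%:R) <= t%:R^-1 :> R.
Proof.
rewrite /avg ler_piMr ?invr_ge0// -natr_sum lern1.
pose P := [pred x : 'I_t | slab x.+1 && ~~ slab x].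
have -> : (\sum_(x < t) (slab x.+1 && ~~ slab x) = #|P|)%N.
  rewrite -sum1_card [RHS]big_mkcond/=; apply: eq_bigr => x _.
  by rewrite unfold_in/=; case: ifP.
apply/card_le1_eqP => x y.
rewrite !unfold_in/= => /andP[x1 x0] /andP[y1 y0]; apply: val_inj => /=.
have := slab_start_unique x1 x0 y1 y0.
by rewrite !modn_small.
Qed.

(** Walking ahead from such an x, the visible set is entered at some step i < W, and then x + i + l
    enters the slab for some l in [Lam t]. For fixed i and l this has frequency at most 1 / t, and
    there are W times |Lam t| pairs. *)
Lemma avg_boundary W :
  avg t (fun x => (~~ visible x && [exists i : 'I_W.+1, visible (x + i)])%:R) <=
  W%:R * density R (Lam t) :> R.
Proof.
pose V z := slab z.+1 && ~~ slab z.
have VP : has_period t (fun z => (V z)%:R : R).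
  by move=> z; rewrite /V -addSn !slab_period.
have enter x i : ~~ visible x -> visible (x + i) ->
    exists2 j, (j < i)%N & ~~ visible (x + j) && visible (x + j).+1.
  elim: i => [|i IH] nx; first by rewrite addn0 (negbTE nx).
  have [xi _|xi] := boolP (visible (x + i)).
    by have [j ji h] := IH nx xi; exists j => //; exact: ltnW.
  by rewrite addnS => xi1; exists i => //; rewrite xi xi1.
pose F i l x : R := (res t l)%:R * (V (x + (i + l))%N)%:R.
have le1 : avg t (fun x =>
    (~~ visible x && [exists i : 'I_W.+1, visible (x + i)])%:R) <=
    avg t (fun x => \sum_(i < W) \sum_(l < t) F i l x).
  apply: le_avg => x _.
  have [/andP[nx /existsP[i xi]]|_] := boolP (_ && _); last first.
    by rewrite sumr_ge0// => i _; rewrite sumr_ge0// => l _; rewrite mulr_ge0.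
  have [j ji /andP[nxj /existsP[l /andP[rl sl]]]] := enter _ _ nx xi.
  have jW : (j < W)%N by rewrite (leq_trans ji)// -ltnS.
  have F0 i' l' : 0 <= F i' l' x by rewrite mulr_ge0.
  apply: (@le1_sum _ (fun i : 'I_W => \sum_(l < t) F i l x)
    (Ordinal jW)) => [k|]; first exact: sumr_ge0.
  apply: (@le1_sum _ (fun l : 'I_t => F (Ordinal jW) l x) l) => //=.
  rewrite /F rl mul1r /V /= addnA -addSn sl /=.
  move: nxj; rewrite negb_exists => /forallP/(_ l); rewrite rl /= => ->.
  by [].
apply: le_trans le1 _.
rewrite (avg_sum _ _ (fun i x => \sum_(l < t) F i l x)).
rewrite mulr_natl -[X in _ *+ X](card_ord W) -sumr_const.
apply: ler_sum => i _.
rewrite (avg_sum _ _ (F i)).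
under eq_bigr do rewrite avgZ (avg_shift _ VP).
rewrite -mulr_suml -card_res card_density//.
rewrite mulrC mulrA ler_piMl ?density_ge0//.
by rewrite -ler_pdivlMr ?ltr0n// mul1r; exact: avg_slab_start.
Qed.

Definition is_far (u v : 'Z_t) :=
  [forall w in Lam t, g * s < (cyc_abs (u - v - w))%:R].

Lemma card_far_pairs : #|far_pairs g (Lam t)|%:R =
  \sum_(u : 'Z_t) \sum_(v : 'Z_t)
    [&& u \in Lam t, v \in Lam t & is_far u v]%:R :> R.
Proof.
rewrite pair_bigA/= -sum1_card natr_sum big_mkcond/=.
by apply: eq_bigr => -[u v] _; rewrite !inE/= -andbA; case: ifP.
Qed.

Lemma far_pairs_ratio_le1 :
  #|far_pairs g (Lam t)|%:R / #|Lam t|%:R ^+ 2 <= 1 :> R.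
Proof.
have A0 : 0 < #|Lam t|%:R :> R by rewrite card_density// mulr_gt0// ltr0n.
rewrite ler_pdivrMr ?exprn_gt0// mul1r.
rewrite -natrX ler_nat expnS expn1 -cardsX subset_leq_card//.
by apply/fintype.subsetP => uv; rewrite !inE => /andP[].
Qed.

(** If some x + v + w were also in the slab, then x + u = - r1 and x + v + w = - r2 with r1, r2 < g
    s, so u - v - w = r2 - r1 would be too close to 0. *)
Lemma far_not_visible x (u v : 'Z_t) : slab (x + u) -> is_far u v ->
  ~~ visible (x + v).
Proof.
move=> su /forallP uv; apply/negP => /existsP[w /andP[rw sw]].
have [r1 [r10 r1s e1]] := slabP su; have [r2 [r20 r2s e2]] := slabP sw.
have := uv w%:R; rewrite -/(res t w) rw /= => lt.
have e : (r2%:Z - r1%:Z)%:~R = u - v - w%:R.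
  rewrite intrB -!pmulrn; apply/eqP; rewrite -subr_eq0; apply/eqP.
  rewrite -[RHS](subrr 0) -{1}e2 -e1 !natrD !natr_Zp; ring.
have [/(_ _ e) + _] := cyc_abs_min (u - v - w%:R) t_gt1.
have : (`|r2%:Z - r1%:Z| <= maxn r1 r2)%N by lia.
move=> le1 le2; have := leq_trans le2 le1.
rewrite -(ler_nat R) leNgt => /negP; apply.
by apply: le_lt_trans lt; rewrite /maxn; case: ifP => _; exact: ltW.
Qed.

Lemma outsideE x :
  outside x = (\sum_(v : 'Z_t) (v \in Lam t)%:R * (~~ visible (x + v))%:R) /
              #|Lam t|%:R.
Proof.
rewrite card_density// /outside /avg.
rewrite -(sum_Zp (fun v => wgt t v * (~~ visible (x + v))%:R))//.
rewrite [RHS]mulrC invfM -mulrA; congr (_ * _).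
rewrite mulr_sumr; apply: eq_bigr => v _.
by rewrite /wgt /res natr_Zp mulrAC mulrC.
Qed.

(* For each u with x + u in the slab, [outside x] is at least the proportion of
   v far from u; those u for which this proportion is less than alpha make up at
   most 1 - 4 alpha of Lambda_t. *)
Lemma avg_visible_not_outside :
  5 * alpha < #|far_pairs g (Lam t)|%:R / #|Lam t|%:R ^+ 2 ->
  avg t (fun x => (visible x && (outside x < alpha))%:R) <= (1 - 4 * alpha) * g.
Proof.
set A := Lam t; have A0 : 0 < #|A|%:R :> R.
  by rewrite card_density// mulr_gt0// ltr0n.
move=> far.
pose N (u : 'Z_t) := \sum_(v : 'Z_t) (v \in A)%:R * (is_far u v)%:R : R.
pose bad x := res t x && (N x%:R < alpha * #|A|%:R).
have Ncard u : N u <= #|A|%:R.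
  rewrite -sum1_card natr_sum big_mkcond/=; apply: ler_sum => v _.
  by case: ifP => _; rewrite ?mul0r// mul1r lern1 leq_b1.
have alpha5 : 5 * alpha < 1.
  exact: lt_le_trans far far_pairs_ratio_le1.
(* Each bad u has fewer than alpha |A| far partners and every other u at most |A|. With b bad
   elements, more than 5 alpha |A|^2 far pairs force (1 - alpha) b < (1 - 5 alpha) |A|, and b <= |A|
   then yields the constant 4. *)
have cbad : \sum_(l < t) (bad l)%:R <= (1 - 4 * alpha) * #|A|%:R.
  rewrite -(sum_Zp (fun l => (bad l)%:R))//.
  have : #|far_pairs g A|%:R <= \sum_(u : 'Z_t)
     ((u \in A)%:R * #|A|%:R - (bad u)%:R * ((1 - alpha) * #|A|%:R)).
    rewrite card_far_pairs; apply: ler_sum => u _.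
    rewrite -/A /bad /res natr_Zp; case: (u \in A); rewrite /= ?mul0r ?subr0.
      have -> : \sum_(v : 'Z_t) ((v \in A) && is_far u v)%:R = N u.
        by apply: eq_bigr => v _; rewrite -mulnb natrM.
      rewrite mul1r; case: ltP => [h|_]; rewrite ?mul0r ?subr0//.
      by rewrite mul1r; apply: le_trans (ltW h) _; lra.
    by rewrite big1.
  rewrite sumrB -mulr_suml -mulr_suml.
  have -> : \sum_(u : 'Z_t) (u \in A)%:R = #|A|%:R :> R.
    rewrite -sum1_card natr_sum [RHS]big_mkcond/=; apply: eq_bigr => u _.
    by case: ifP.
  set b := \sum_(u : 'Z_t) _ => le1.
  have bA : b <= #|A|%:R.
    rewrite -sum1_card natr_sum big_mkcond/=; apply: ler_sum => u _.
    by rewrite /bad /res natr_Zp; case: (_ \in _) => //=; rewrite lern1 leq_b1.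
  rewrite -(ler_pM2r A0).
  move: far; rewrite ltr_pdivlMr ?exprn_gt0// => /lt_le_trans/(_ le1); nra.
apply: (@le_trans _ _ (avg t (fun x =>
    [exists l : 'I_t, bad l && slab (x + l)]%:R))).
  apply: le_avg => x _; case: (boolP (_ && _)) => // /andP[].
  move=> /existsP[u /andP[ru su]] ox.
  case: existsP => // -[]; exists u; rewrite su andbT /bad ru /= ltNge.
  apply/negP => le1; move: ox; rewrite ltNge => /negP; apply.
  rewrite outsideE ler_pdivlMr//; apply: le_trans le1 _.
  apply: ler_sum => v _; rewrite ler_wpM2l//.
  have [uv|] := boolP (is_far _ _); last by rewrite ler0n.
  rewrite (@far_not_visible x u%:R v)//.
  by rewrite -(has_period_modD x u slab_period) -(val_Zp_nat t_gt1) in su.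
apply: le_trans (avg_exists_slab bad) _.
apply: le_trans (ler_wpM2r _ cbad) _; first exact: avg_ge0.
rewrite -mulrA ler_wpM2l//; last exact: card_avg_slab.
lra.
Qed.

End Thickening.

(** * Translations that are constant on blocks *)

Section BlockShifts.
Variable R : realType.

(** The amount of translation depends only on x mod P; for each such residue, x mod T still runs
    over a full period. *)
Lemma avg_block_shift P B T (s : nat -> nat) (f : nat -> R) :
  (0 < P)%N -> coprime P T -> has_period T f ->
  avg (P * T) (fun x => f (x + s (x %% P %/ B))%N) = avg T f.
Proof.
move=> P0 co fT.
rewrite -(avg_cst (avg T f) P0).
rewrite -(@eq_avg _ _ (fun x => f (x %% T + s (x %% P %/ B))%N)); last first.
  by move=> x _; rewrite addnC (has_period_modD _ _ fT) addnC.
rewrite (avg_crt (fun u v => f (v + s (u %/ B))%N))//.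
by apply: eq_avg => u _; rewrite avg_shift.
Qed.

(** The second condition handles the end of the period, where the last block may be shorter than B
    and x + W could wrap around. *)
Definition inner_block (P B W x : nat) : bool :=
  ((x %% P) %% B + W < B)%N && (x %% P + W < P)%N.

Lemma inner_block_shift P B W x i : inner_block P B W x -> (i <= W)%N ->
  ((x + i) %% P %/ B = x %% P %/ B)%N.
Proof.
move=> /andP[b1 b2] iW.
have -> : ((x + i) %% P = x %% P + i)%N.
  rewrite -modnDml modn_small//.
  by apply: leq_ltn_trans b2; rewrite leq_add2l.
have B0 : (0 < B)%N by exact: leq_ltn_trans b1.
rewrite {1}(divn_eq (x %% P) B) -addnA divnMDl//.
rewrite [X in (_ + X)%N]divn_small ?addn0//.
by apply: leq_ltn_trans b1; rewrite leq_add2l.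
Qed.

(** At most P / B + 1 blocks lose W points each, and W more are lost at the end of the period; since
    B <= P, this is at most 3 W P / B points. *)
Lemma avg_not_inner_block P B W : (0 < B)%N -> (B <= P)%N ->
  avg P (fun x => (~~ inner_block P B W x)%:R) <= 3 * W%:R / B%:R :> R.
Proof.
move=> B0 BP; have P0 : (0 < P)%N by exact: leq_trans BP.
pose f x : R := (B <= x %% B + W)%N%:R.
have fB : has_period B f by move=> x; rewrite /f modnDr.
have sumf : \sum_(x < P) f x <= (P %/ B).+1%:R * W%:R.
  apply: (@le_trans _ _ (\sum_(x < B * (P %/ B).+1) f x)).
    have PB : (P <= B * (P %/ B).+1)%N by rewrite mulnC ltnW// ltn_ceil.
    rewrite -(subnKC PB) big_split_ord/= lerDl sumr_ge0//.
  have -> : \sum_(x < B * (P %/ B).+1) f x =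
      (P %/ B).+1%:R * (\sum_(x < B) f x).
    have := avg_widen B0 (ltn0Sn (P %/ B)) fB; rewrite /avg natrM => e.
    have BE : B%:R != 0 :> R by rewrite pnatr_eq0 -lt0n.
    have kE : (P %/ B).+1%:R != 0 :> R by rewrite pnatr_eq0.
    have /(congr1 (fun z => B%:R * (P %/ B).+1%:R * z)) := e.
    rewrite mulVKf ?mulf_neq0// => ->; field; exact: BE.
  rewrite ler_wpM2l// -natr_sum ler_nat.
  apply: leq_trans (sum_range_le (B - W) W B); apply: leq_sum => x _.
  rewrite modn_small//; have := ltn_ord x; lia.
have sumg : \sum_(x < P) (P <= x + W)%N%:R <= W%:R :> R.
  rewrite -natr_sum ler_nat.
  apply: leq_trans (sum_range_le (P - W) W P); apply: leq_sum => x _.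
  have := ltn_ord x; lia.
rewrite /avg mulrC ler_pdivrMr ?ltr0n//.
apply: (@le_trans _ _ (\sum_(x < P) f x + \sum_(x < P) (P <= x + W)%N%:R)).
  rewrite -big_split/=; apply: ler_sum => x _.
  rewrite /inner_block [(x %% P)%N]modn_small// negb_and -!leqNgt.
  rewrite /f -natrD ler_nat.
  by case: (B <= _)%N; case: (P <= _)%N.
apply: le_trans (lerD sumf sumg) _.
have kP : (P %/ B)%:R * B%:R <= P%:R :> R by rewrite -natrM ler_nat leq_divM.
have B0' : 0 < B%:R :> R by rewrite ltr0n.
have BP' : B%:R <= P%:R :> R by rewrite ler_nat.
have W0 : 0 <= W%:R :> R by [].
rewrite mulrAC ler_pdivlMr// -natr1.
nra.
Qed.

End BlockShifts.

(** * Averages over translates of Lambda_T *)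

Section Smoothing.
Variables (R : realType) (Lam : forall t : nat, {set 'Z_t}) (T : nat).
Variable f : nat -> R.
Hypotheses (T_gt1 : (1 < T)%N) (density_gt0 : 0 < density R (Lam T)).
Hypotheses (f_ge0 : forall x, 0 <= f x) (f_period : has_period T f).

Definition smooth (x : nat) : R :=
  avg T (fun c => wgt R Lam T c * f (x + c)%N).

Lemma smooth_period : has_period T smooth.
Proof. by move=> x; apply: eq_avg => c _; rewrite addnAC f_period. Qed.

Lemma avg_smooth : avg T smooth = avg T f.
Proof.
rewrite /smooth (avg_exchange _ _ (fun x c => wgt R Lam T c * f (x + c)%N)).
under eq_avg do rewrite avgZ (avg_shift _ f_period) mulrC.
by rewrite avgZ avg_wgt// mulr1.
Qed.

(** Both terms lie between 0 and T times the mean, the pointwise maximum of [f] being at most its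
    sum over a period. Only finiteness of this bound matters, as P is chosen after it. *)
Lemma smooth_dev x : `|smooth x - avg T f| <= T%:R * avg T f.
Proof.
have T0 : (0 < T)%N by exact: ltnW.
have s0 : 0 <= smooth x by apply: avg_ge0 => c; rewrite mulr_ge0// wgt_ge0.
have s1 : smooth x <= T%:R * avg T f.
  have -> : T%:R * avg T f = avg T (fun c => T%:R * avg T f * wgt R Lam T c).
    by rewrite avgZ avg_wgt// mulr1.
  apply: le_avg => c _; rewrite mulrC ler_wpM2r ?wgt_ge0//.
  exact: avg_le_mass.
have a0 : 0 <= avg T f by exact: avg_ge0.
have a1 : avg T f <= T%:R * avg T f by rewrite ler_peMl// ler1n.
by rewrite ler_norml; apply/andP; split; lra.
Qed.

End Smoothing.

(** * Combining two functions *)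

Section Combination.
Variables (R : realType) (Lam : forall t : nat, {set 'Z_t}).
Hypothesis Lam_coprime : forall s t : nat, (1 < s)%N -> (1 < t)%N ->
  coprime s t ->
  periodic (Lam (s * t)%N) = periodic (Lam s) `&` periodic (Lam t).

Variables (t P T1 T2 B W : nat) (s : nat -> nat) (g alpha m : R).
Variables (f1 f2 X1 X2 : nat -> R).
Hypotheses (t_gt1 : (1 < t)%N) (P_gt1 : (1 < P)%N).
Hypotheses (T1_gt1 : (1 < T1)%N) (T2_gt1 : (1 < T2)%N).
Hypothesis t_density : 0 < density R (Lam t).
Hypotheses (P_T2 : coprime P T2) (t_PT2 : coprime t (P * T2)).
Hypothesis t_T1 : coprime t T1.
Hypotheses (g_gt0 : 0 < g) (f1_ge0 : forall x, 0 <= f1 x).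
Hypothesis f2_ge0 : forall x, 0 <= f2 x.
Hypotheses (f1_period : has_period T1 f1) (f2_period : has_period T2 f2).
Hypotheses (X1_ge0 : forall x, 0 <= X1 x) (X2_ge0 : forall x, 0 <= X2 x).
Hypotheses (X1_period : has_period T1 X1) (X2_period : has_period T2 X2).
Hypotheses (alpha_ge0 : 0 <= alpha) (m_ge0 : 0 <= m).

Local Notation wgt := (wgt R Lam).
Local Notation vis := (visible Lam t g).
Local Notation out := (outside Lam t g).
Local Notation T := (t * (P * T2) * T1)%N.

Definition shift (x : nat) : nat := (x + s (x %% P %/ B))%N.

Definition hidden (x : nat) : R := (~~ vis x)%:R * f2 (shift x).

Definition concentrated (x : nat) : R :=
  #|Lam t|%:R * ((slab Lam t g x)%:R * f1 x).

(* What the part of f2 off the visible set contributes on average, apart from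
   the factor [outside x]. *)
Definition far_mass (x : nat) : R :=
  shifted_avg P B (wgt P) (smooth Lam T2 f2) s x.

(** Where W steps ahead may enter the visible set or leave the block, [hidden] need not look like a
    translate of [f2]; there the minorant is 0, which costs only the density of such points. *)
Definition gain (x : nat) : R :=
  if vis x then
    X1 x + (if (alpha <= out x) && (m <= far_mass x) then alpha * m else 0)
  else if ~~ [exists i : 'I_W.+1, vis (x + i)] && inner_block P B W x then
    X2 (shift x)
  else 0.

Let t0 : (0 < t)%N. Proof. exact: ltnW. Qed.
Let P0 : (0 < P)%N. Proof. exact: ltnW. Qed.
Let T10 : (0 < T1)%N. Proof. exact: ltnW. Qed.
Let T20 : (0 < T2)%N. Proof. exact: ltnW. Qed.
Let PT20 : (0 < P * T2)%N. Proof. by rewrite muln_gt0 P0. Qed.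
Let T0 : (0 < T)%N. Proof. by rewrite !muln_gt0 t0 P0 T20. Qed.

Let visP : has_period t vis.
Proof. by move=> x; rewrite visible_period. Qed.

Lemma shift_period (V : Type) (f : nat -> V) : has_period T2 f ->
  has_period (P * T2) (fun x => f (shift x)).
Proof.
move=> fT x; rewrite /shift.
have -> : ((x + P * T2) %% P = x %% P)%N by rewrite addnC mulnC modnMDl.
by rewrite addnAC (has_period_mull _ fT).
Qed.

Lemma hidden_ge0 x : 0 <= hidden x.
Proof. by rewrite mulr_ge0. Qed.

Lemma hidden_period : has_period (t * (P * T2)) hidden.
Proof.
move=> x; rewrite /hidden (has_period_mulr _ visP).
by rewrite (has_period_mull _ (shift_period f2_period)).
Qed.

Lemma concentrated_ge0 x : 0 <= concentrated x.
Proof. by rewrite !mulr_ge0. Qed.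

Lemma concentrated_period : has_period (t * T1) concentrated.
Proof.
move=> x; rewrite /concentrated (has_period_mull _ f1_period).
by rewrite (has_period_mulr _ (@slab_period R Lam t g)).
Qed.

Let T1_dvd : (T1 %| T)%N. Proof. exact: dvdn_mull. Qed.
Let PT2_dvd : (P * T2 %| T)%N.
Proof. by rewrite dvdn_mulr// dvdn_mull. Qed.
Let t_dvd : (t %| T)%N. Proof. by rewrite -mulnA dvdn_mulr. Qed.
Let P_dvd : (P %| T)%N.
Proof. by rewrite (dvdn_trans _ PT2_dvd)// dvdn_mulr. Qed.
Let tT1_dvd : (t * T1 %| T)%N.
Proof. by rewrite -mulnA dvdn_pmul2l// dvdn_mull. Qed.
Let tPT2_dvd : (t * (P * T2) %| T)%N. Proof. exact: dvdn_mulr. Qed.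

Let avg_not_vis : avg t (fun x => (~~ vis x)%:R) =
  1 - avg t (fun x => (vis x)%:R) :> R.
Proof.
apply/eqP; rewrite eq_sym subr_eq -avgD; apply/eqP.
rewrite -[LHS](@avg_cst _ t)//; apply: eq_avg => x _.
by rewrite -natrD; case: (vis x).
Qed.

Lemma avg_hidden :
  avg T hidden = (1 - avg t (fun x => (vis x)%:R)) * avg T2 f2.
Proof.
rewrite (avg_dvd tPT2_dvd)//; last exact: hidden_period.
rewrite (@avgM _ _ _ (fun x => (~~ vis x)%:R) (fun x => f2 (shift x)))//.
- by rewrite avg_not_vis (@avg_block_shift _ P B T2 s f2).
- by move=> x; rewrite visP.
- exact: shift_period.
Qed.

Lemma avg_concentrated : avg T concentrated <= g * avg T1 f1.
Proof.
rewrite avgZ (@avg_dvd _ (t * T1))//; last first.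
  move=> x; rewrite (has_period_mull _ f1_period).
  by rewrite (has_period_mulr _ (@slab_period R Lam t g)).
rewrite (@avgM _ _ _ (fun x => (slab Lam t g x)%:R))//; last first.
  by move=> x; rewrite slab_period.
rewrite mulrA ler_wpM2r ?avg_ge0//.
exact: card_avg_slab.
Qed.

(** The weight splits over the moduli t, P and T2. Visibility depends on v mod t only and the
    translated [f2] on v mod P and mod T2, so the average factors. *)
Lemma avg_wgt_hidden x :
  avg (t * (P * T2)) (fun v => wgt (t * (P * T2))%N v * hidden (x + v)) =
  out x * far_mass x.
Proof.
have PT21 : (1 < P * T2)%N by rewrite (leq_trans P_gt1)// leq_pmulr.
pose Phi u c := wgt P u * (wgt T2 c * f2 (x + c + s ((x + u) %% P %/ B))%N).
transitivity (avg (t * (P * T2)) (fun v =>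
    (wgt t v * (~~ vis (x + v))%:R) * Phi (v %% P)%N (v %% T2)%N)).
  apply: eq_avg => v _; rewrite wgt_mul// wgt_mul// /hidden /Phi /shift.
  rewrite (has_period_mod _ (@wgt_period R Lam P P_gt1)).
  rewrite (has_period_mod _ (@wgt_period R Lam T2 T2_gt1)) modnDmr.
  rewrite addnAC [in RHS]addnAC (has_period_modD _ _ f2_period).
  by rewrite mulrACA -!mulrA.
rewrite avgM//.
- congr (_ * _); rewrite avg_crt//; apply: eq_avg => u _.
  rewrite /Phi avgZ; congr (_ * _); apply: eq_avg => c _.
  by rewrite addnAC.
- move=> v; rewrite wgt_period//; congr (_ * (~~ _)%:R).
  by rewrite addnA visP.
- move=> v; congr (Phi _ _).
    by rewrite addnC mulnC modnMDl.
  by rewrite addnC modnMDl.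
Qed.

Lemma far_mass_period : has_period (P * T2) far_mass.
Proof.
move=> x; apply: eq_avg => b _; congr (_ * _).
have -> : ((x + P * T2 + b) %% P = (x + b) %% P)%N.
  by rewrite addnAC addnC mulnC modnMDl.
by rewrite addnAC (has_period_mull _ (smooth_period Lam f2_period)).
Qed.

Lemma far_mass_ge0 x : 0 <= far_mass x.
Proof.
apply: avg_ge0 => b; rewrite mulr_ge0 ?wgt_ge0//.
by apply: avg_ge0 => v; rewrite mulr_ge0 ?wgt_ge0.
Qed.

Lemma gain_ge0 x : 0 <= gain x.
Proof.
rewrite /gain; case: ifP => _; last by case: ifP.
by rewrite addr_ge0//; case: ifP => // _; rewrite mulr_ge0.
Qed.

Lemma inner_block_period : has_period P (inner_block P B W).
Proof. by move=> x; rewrite /inner_block modnDr. Qed.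

Let bnd x := [exists i : 'I_W.+1, vis (x + i)].

Let bndP : has_period t bnd.
Proof. by move=> x; apply: eq_existsb => i; rewrite addnAC visP. Qed.

Let visT : has_period T vis.
Proof. by case/dvdnP: t_dvd => k ->; exact: has_period_mull. Qed.

Lemma gain_period : has_period T gain.
Proof.
have dvd V d (f : nat -> V) : (d %| T)%N -> has_period d f -> has_period T f.
  by case/dvdnP => k ->; exact: has_period_mull.
move=> x; rewrite /gain visT (dvd _ _ _ T1_dvd X1_period).
rewrite (dvd _ _ _ t_dvd (@outside_period R Lam t g)).
rewrite (dvd _ _ _ PT2_dvd far_mass_period).
rewrite (dvd _ _ _ P_dvd inner_block_period).
rewrite (dvd _ _ _ PT2_dvd (shift_period X2_period)).
by have := dvd _ _ _ t_dvd bndP x; rewrite /bnd => ->.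
Qed.

Let kappa : R := 1 - expR (- (alpha * m)).

Let kappa_ge0 : 0 <= kappa.
Proof. by rewrite subr_ge0 -expR0 ler_expR oppr_le0 mulr_ge0. Qed.

Let expN_le1 z : 0 <= z -> expR (- z) <= 1 :> R.
Proof. by move=> z0; rewrite -expR0 ler_expR oppr_le0. Qed.

(** Case analysis along [gain], with the exponential bounded by 1 on the exceptional sets, whose
    indicators are the remaining summands. *)
Lemma exp_gain_le x : expR (- gain x) <=
  ((vis x)%:R - kappa * (vis x && (alpha <= out x))%:R) * expR (- X1 x) +
  (far_mass x < m)%R%:R + (~~ vis x)%:R * expR (- X2 (shift x)) +
  (~~ vis x && bnd x)%:R + (~~ inner_block P B W x)%:R.
Proof.
have e1 : expR (- X1 x) <= 1 by exact: expN_le1.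
have e10 : 0 <= expR (- X1 x) by exact: expR_ge0.
have e2 : 0 <= expR (- X2 (shift x)) by exact: expR_ge0.
rewrite /gain -/(bnd x); case: (vis x) => /=.
  rewrite mul0r !addr0; apply: (@le_trans _ _ ((1 - kappa *
      (alpha <= out x)%R%:R) * expR (- X1 x) + (far_mass x < m)%R%:R));
      last first.
    by rewrite lerDl ler0n.
  rewrite [m <= _]leNgt; case: (alpha <= out x); case: ltP => _ /=;
    rewrite ?mulr0 ?mulr1 ?addr0 ?subr0 ?mul1r//.
  - have := expR_ge0 (- (alpha * m)) : 0 <= _ :> R; rewrite /kappa; nra.
  - by rewrite opprD expRD mulrC /kappa subKr.
  - by rewrite lerDl.
rewrite mulr0 subrr mul0r add0r mul1r.
case: (bnd x) => /=.
  by rewrite oppr0 expR0; rewrite -[leLHS]add0r -addrA lerD ?lerDl ?addr_ge0.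
case: (inner_block P B W x) => /=.
  by rewrite !addr0 lerDr.
by rewrite oppr0 expR0 addr0 lerDr ?addr_ge0.
Qed.

Lemma avg_exp_gain : (0 < B)%N -> (B <= P)%N ->
  avg t (fun x => (vis x && (out x < alpha))%:R) <= (1 - 4 * alpha) * g ->
  avg T (fun x => expR (- gain x)) <=
    g * (1 - 4 * alpha * kappa) * avg T1 (fun x => expR (- X1 x)) +
    avg (P * T2) (fun x => (far_mass x < m)%R%:R) +
    (1 - avg t (fun x => (vis x)%:R)) * avg T2 (fun x => expR (- X2 x)) +
    W%:R * density R (Lam t) + 3 * W%:R / B%:R.
Proof.
move=> B0 BP bad.
apply: le_trans (le_avg (fun x _ => exp_gain_le x)) _.
rewrite !avgD; apply: lerD; first apply: lerD; first apply: lerD;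
  first apply: lerD.
- pose h x := (vis x)%:R - kappa * (vis x && (alpha <= out x))%:R.
  have hP : has_period t h.
    by move=> x; rewrite /h visP outside_period.
  rewrite (@avg_dvd _ (t * T1) _ (fun x => h x * expR (- X1 x)))//; last first.
    move=> x; by rewrite (has_period_mull _ X1_period) (has_period_mulr _ hP).
  rewrite (@avgM _ _ _ h)//; last by move=> x; rewrite X1_period.
  rewrite ler_wpM2r//; first by apply: avg_ge0 => x; exact: expR_ge0.
  (* Rewritten so that both coefficients are nonnegative and only upper bounds are needed: (1 -
     kappa) g + kappa (1 - 4 alpha) g = g (1 - 4 alpha kappa). *)
  have -> : avg t h = (1 - kappa) * avg t (fun x => (vis x)%:R) +
      kappa * avg t (fun x => (vis x && (out x < alpha))%:R).
    rewrite -!avgZ -avgD; apply: eq_avg => x _; rewrite /h ltNge.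
    by case: (vis x); case: (_ <= _) => /=; ring.
  have := ler_wpM2l kappa_ge0 bad.
  have k1 : 0 <= 1 - kappa by rewrite /kappa subKr expR_ge0.
  have := ler_wpM2l k1 (avg_visible_le t_gt1 g_gt0 t_density).
  lra.
- by rewrite (@avg_dvd _ (P * T2))// => x; rewrite far_mass_period.
- rewrite (@avg_dvd _ (t * (P * T2)))//; last first.
    move=> x; rewrite (has_period_mull _ (shift_period X2_period)).
    by rewrite (has_period_mulr _ visP).
  rewrite (@avgM _ _ _ (fun x => (~~ vis x)%:R)
    (fun x => expR (- X2 (shift x))))//.
  + rewrite avg_not_vis.
    rewrite (@avg_block_shift _ P B T2 s (fun x => expR (- X2 x)))//.
    by move=> x; rewrite X2_period.
  + by move=> x; rewrite visP.
  + by move=> x; rewrite (shift_period X2_period).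
- rewrite (@avg_dvd _ t)//; first exact: avg_boundary.
  by move=> x; rewrite visP bndP.
- rewrite (@avg_dvd _ P)//; first exact: avg_not_inner_block.
  by move=> x; rewrite inner_block_period.
Qed.

End Combination.

(** * The cyclic system *)

Section Rotation.
Variables (R : realType) (T' : nat).
Local Notation T := T'.+1.

(** Carried by 0, ..., T' but defined on all of [nat], so that periodic functions on [nat] serve
    unchanged as functions on the probability space. *)
Definition uniform_below : set nat -> \bar R :=
  mscale (T%:R^-1)%:nng (msum (fun i => \d_i) T).

HB.instance Definition _ := Measure.on uniform_below.

Lemma uniform_belowE A : uniform_below A = (avg T (\1_A : nat -> R))%:E.
Proof.
rewrite /uniform_below /mscale/= /msum /avg EFinM -sumEFin.
by congr (_ * _)%E; apply: eq_bigr => i _; rewrite diracE.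
Qed.

Let uniform_below_setT : uniform_below setT = 1%E.
Proof. by rewrite uniform_belowE indicT avg_cst. Qed.

HB.instance Definition _ :=
  Measure_isProbability.Build _ _ _ uniform_below uniform_below_setT.

Lemma integral_uniform_below (f : nat -> R) : (forall x, 0 <= f x) ->
  (\int[uniform_below]_x (f x)%:E = (avg T f)%:E)%E.
Proof.
move=> f0; rewrite ge0_integral_mscale//; last by move=> x _; rewrite lee_fin.
rewrite ge0_integral_measure_sum//; last by move=> x _; rewrite lee_fin.
rewrite /avg EFinM -sumEFin; congr (_ * _)%E.
by apply: eq_bigr => i _; rewrite integral_dirac// diracT mul1e.
Qed.

Definition rotation (x : nat) : nat := (x.+1 %% T)%N.

Lemma iter_rotation (f : nat -> R) k x : has_period T f ->
  f (iter k rotation x) = f (x + k)%N.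
Proof.
move=> fT; elim: k x => [|k IH] x; first by rewrite addn0.
rewrite iterSr IH /rotation addnC (has_period_modD _ _ fT).
by rewrite addnC addnS addSn.
Qed.

Lemma rotation_measure_preserving :
  measure_preserving uniform_below rotation.
Proof.
split=> // A _; rewrite !uniform_belowE; congr _%:E.
pose f x : R := \1_A (x %% T)%N.
have fT : has_period T f by move=> x; rewrite /f modnDr.
transitivity (avg T f).
  rewrite -(avg_shift 1 fT); apply: eq_avg => x _.
  rewrite /f !indicE addn1; congr (nat_of_bool _)%:R.
by apply: eq_avg => x xT; rewrite /f modn_small.
Qed.

(** Along an orbit of [rotation] a periodic f takes the values f (x + k), so [good] lies inside the
    set where the maximal function exceeds l. *)
Lemma weak_type_failure (n : nat -> nat) (S : set nat) (f : nat -> R)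
    (C l : R) (good : set nat) :
  0 < l -> (forall x, 0 <= f x) -> has_period T f ->
  (forall x, good x -> exists2 N, S N &
     l < N%:R^-1 * \sum_(k < N) f (x + n k)%N) ->
  C * avg T f < l * avg T (\1_good : nat -> R) ->
  exists (d : measure_display) (X : measurableType d) (mu : probability X R)
         (tau : X -> X) (f : X -> R),
    [/\ measure_preserving mu tau,
        mu.-integrable [set: X] (EFin \o f) &
        (C%:E * 'N[mu]_1[EFin \o f] <
         weak_norm1 mu (maximal_along n S tau f))%E].
Proof.
move=> l0 f0 fT hgood lt.
exists _, nat, uniform_below, rotation, f.
have absf : (\int[uniform_below]_x `|(f x)%:E| = (avg T f)%:E)%E.
  rewrite -integral_uniform_below//; apply: eq_integral => x _.
  by rewrite gee0_abs// lee_fin.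
split.
- exact: rotation_measure_preserving.
- by apply/integrableP; split=> //; rewrite absf ltry.
rewrite Lnorm1 /= absf -EFinM.
apply: (@lt_le_trans _ _ (l%:E * uniform_below good)%E).
  by rewrite uniform_belowE -EFinM lte_fin.
apply: (@le_trans _ _ (l%:E * uniform_below
    [set x | l%:E < `|maximal_along n S rotation f x|])%E).
  rewrite lee_pmul2l// le_measure// ?inE// => x /hgood[N SN lN] /=.
  have lt_max : (l%:E < maximal_along n S rotation f x)%E.
    apply: (@lt_le_trans _ _ `|average_along n rotation f N x|%:E).
      rewrite lte_fin; apply: lt_le_trans (ler_norm _).
      rewrite /average_along; apply: lt_le_trans lN _.
      rewrite le_eqVlt; apply/orP; left; apply/eqP; congr (_ * _).
      by apply: eq_bigr => k _; rewrite iter_rotation.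
    by apply: ereal_sup_ubound; exists N.
  by apply: lt_le_trans lt_max (lee_abs _).
by apply: ereal_sup_ubound; exists l.
Qed.

End Rotation.

(** * The induction *)

Section Moduli.
Variables (R : realType) (Lam : forall t : nat, {set 'Z_t}).
Hypothesis Lam_coprime : forall s t : nat, (1 < s)%N -> (1 < t)%N ->
  coprime s t ->
  periodic (Lam (s * t)%N) = periodic (Lam s) `&` periodic (Lam t).
Local Notation res := (res Lam).
Local Notation wgt := (wgt R Lam).
Variables (p q : nat -> nat).
Hypothesis p_gt1 : forall j, (1 < p j)%N.
Hypothesis q_gt1 : forall j, (1 < q j)%N.
Hypothesis p_coprime : forall i j, i <> j -> coprime (p i) (p j).
Hypothesis q_coprime : forall i j, i <> j -> coprime (q i) (q j).
Hypothesis pq_coprime : forall i j, coprime (p i) (q j).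
Hypothesis density_p_gt0 : forall j, 0 < density R (Lam (p j)).
Hypothesis density_q_gt0 : forall j, 0 < density R (Lam (q j)).

(* Moduli are tracked with a range of indices, so that newly chosen ones are
   coprime to the old ones. *)
Definition within (a b : nat) (I : seq nat) := all (fun i => a <= i < b)%N I.

Definition modulus (a b Q : nat) := exists I J : seq nat,
  [/\ sorted ltn I, sorted ltn J, within a b I && within a b J,
      I <> [::] \/ J <> [::] &
      Q = (\prod_(i <- I) p i * \prod_(j <- J) q j)%N].

Lemma modulus_widen a b a' b' Q : (a' <= a)%N -> (b <= b')%N ->
  modulus a b Q -> modulus a' b' Q.
Proof.
move=> aa bb [I [J [sI sJ /andP[wI wJ] IJ ->]]]; exists I, J; split=> //.
by apply/andP; split; [apply: sub_all wI|apply: sub_all wJ] => i; lia.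
Qed.

Lemma modulus_p i : modulus i i.+1 (p i).
Proof.
exists [:: i], [::]; split=> //=; last by rewrite big_seq1 big_nil muln1.
  by rewrite leqnn ltnSn.
by left.
Qed.

Lemma modulus_q i : modulus i i.+1 (q i).
Proof.
exists [::], [:: i]; split=> //=; last by rewrite big_seq1 big_nil mul1n.
  by rewrite leqnn ltnSn.
by right.
Qed.

Lemma sorted_within_cat a b c I J : sorted ltn I -> sorted ltn J ->
  within a b I -> within b c J -> sorted ltn (I ++ J).
Proof.
rewrite !(sorted_pairwise ltn_trans) pairwise_cat => -> -> /allP wI /allP wJ.
rewrite !andbT; apply/allrelP => x y /wI + /wJ /=; lia.
Qed.

Lemma modulus_mul a b c Q T : (a <= b)%N -> (b <= c)%N ->
  modulus a b Q -> modulus b c T -> modulus a c (Q * T)%N.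
Proof.
move=> ab bc [I [J [sI sJ /andP[wI wJ] IJ ->]]].
move=> [I' [J' [sI' sJ' /andP[wI' wJ'] IJ' ->]]].
exists (I ++ I'), (J ++ J'); split.
- exact: sorted_within_cat wI wI'.
- exact: sorted_within_cat wJ wJ'.
- rewrite /within !all_cat -!andbA; apply/and4P.
  by split; [apply: sub_all wI|apply: sub_all wI'|apply: sub_all wJ|
             apply: sub_all wJ'] => i; lia.
- by case: IJ => [|]; [case: (I) => //; left|case: (J) => //; right].
- by rewrite !big_cat/= mulnACA.
Qed.

Lemma coprime_big_prod (w : nat -> nat) I t :
  (forall i, i \in I -> coprime (w i) t) -> coprime (\prod_(i <- I) w i)%N t.
Proof.
elim: I => [|i I IH] h; first by rewrite big_nil coprime1n.
rewrite big_cons coprimeMl h ?mem_head//= IH// => j jI.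
by rewrite h// inE jI orbT.
Qed.

Lemma modulus_coprime a b c Q T :
  modulus a b Q -> modulus b c T -> coprime Q T.
Proof.
move=> [I [J [_ _ /andP[/allP wI /allP wJ] _ ->]]].
move=> [I' [J' [_ _ /andP[/allP wI' /allP wJ'] _ ->]]].
rewrite coprimeMl; apply/andP; split; apply: coprime_big_prod => i iI;
  rewrite coprime_sym coprimeMl; apply/andP; split; apply: coprime_big_prod.
- by move=> j jI; apply: p_coprime => ij;
     have := wI _ iI; have := wI' _ jI; lia.
- by move=> j jI; rewrite coprime_sym.
- by move=> j jI.
- by move=> j jI; apply: q_coprime => ij;
     have := wJ _ iI; have := wJ' _ jI; lia.
Qed.

(** The empty product is 1, a modulus for which [Lam] has no meaning; hence the alternative. *)
Lemma prod_density_gt0 (w : nat -> nat) I : (forall j, (1 < w j)%N) ->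
  (forall i j, i <> j -> coprime (w i) (w j)) ->
  (forall j, 0 < density R (Lam (w j))) -> uniq I ->
  I = [::] \/ (1 < \prod_(i <- I) w i)%N /\
              0 < density R (Lam (\prod_(i <- I) w i)%N).
Proof.
move=> w1 wc wd; elim: I => [|i I IH]/=; first by left.
move=> /andP[iI uI]; right; rewrite big_cons.
have [->|[P1 P0]] := IH uI; first by rewrite big_nil muln1; split.
split; first by rewrite (leq_trans (w1 i))// leq_pmulr// ltnW.
rewrite density_mul//; first exact: mulr_gt0.
rewrite coprime_sym.
by apply: coprime_big_prod => j jI; apply: wc => ji; rewrite -ji jI in iI.
Qed.

Lemma modulus_good a b Q : modulus a b Q ->
  (1 < Q)%N /\ 0 < density R (Lam Q).
Proof.
move=> [I [J [sI sJ _ IJ ->]]].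
have uI : uniq I by apply: sorted_uniq sI; [exact: ltn_trans|exact: ltnn].
have uJ : uniq J by apply: sorted_uniq sJ; [exact: ltn_trans|exact: ltnn].
have [I0|[PI1 PI0]] := prod_density_gt0 p_gt1 p_coprime density_p_gt0 uI;
have [J0|[PJ1 PJ0]] := prod_density_gt0 q_gt1 q_coprime density_q_gt0 uJ.
- by case: IJ.
- by rewrite I0 big_nil mul1n.
- by rewrite J0 big_nil muln1.
split; first by rewrite (leq_trans PI1)// leq_pmulr// ltnW.
rewrite density_mul//; first exact: mulr_gt0.
apply: coprime_big_prod => i _; rewrite coprime_sym.
by apply: coprime_big_prod => j _; rewrite coprime_sym.
Qed.

Lemma modulus_gt1 a b Q : modulus a b Q -> (1 < Q)%N.
Proof. by move=> /modulus_good[]. Qed.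

(** * Equidistribution along residue classes *)

Variables (n : nat -> nat) (beta : R).
Hypothesis beta_gt0 : 0 < beta.
Hypothesis equidistribution : forall I J : seq nat,
  sorted ltn I -> sorted ltn J -> I <> [::] \/ J <> [::] ->
  let Q := (\prod_(i <- I) p i * \prod_(j <- J) q j)%N in
  forall a : 'Z_Q, a \in Lam Q ->
  beta / #|Lam Q|%:R <
  limn_inf (fun N : nat =>
    N%:R^-1 * #|[set k : 'I_N | (n k)%:R == a]%SET|%:R).

Lemma modulus_equidistributed a b Q c : modulus a b Q -> res Q c ->
  exists K, forall N, (K <= N)%N ->
    N%:R * (beta / #|Lam Q|%:R) <= \sum_(k < N) (n k == c %[mod Q])%:R.
Proof.
move=> mQ; have Q1 := modulus_gt1 mQ; case: mQ.
move=> I [J [sI sJ _ IJ QE]] cQ.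
have := @equidistribution I J sI sJ IJ; rewrite -QE => /(_ _ cQ).
move=> /(@limn_inf_gt _ _ 0 1)[|K KP].
  move=> N; rewrite mulr_ge0 ?invr_ge0//=.
  have [->|N0] := posnP N; first by rewrite invr0 mul0r.
  rewrite ler_pdivrMl ?ltr0n// mulr1 ler_nat.
  by rewrite (leq_trans (max_card _))// card_ord.
exists K => N /KP; have [->|N0] := posnP N; first by rewrite mul0r big_ord0.
move=> /ltW; rewrite ler_pdivlMl ?ltr0n//.
suff -> : #|[set k : 'I_N | (n k)%:R == c%:R :> 'Z_Q]%SET|%:R =
  \sum_(k < N) (n k == c %[mod Q])%:R :> R by [].
rewrite -sum1_card natr_sum big_mkcond/=; apply: eq_bigr => k _.
by rewrite inE natr_Zp_eq//; case: ifP.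
Qed.

(* The average of f along the n_k congruent to a mod Q, normalized as if these
   made up a proportion 1 / |Lambda_Q| of all k < N. *)
Definition seen (Q N a : nat) (f : nat -> R) (x : nat) : R :=
  #|Lam Q|%:R / N%:R * \sum_(k < N) (n k == a %[mod Q])%:R * f (x + n k)%N.

Lemma le_seen Q N a f g x y :
  (forall k, (k < N)%N -> f (x + n k)%N <= g (y + n k)%N) ->
  seen Q N a f x <= seen Q N a g y.
Proof.
move=> fg; rewrite ler_wpM2l ?divr_ge0//; apply: ler_sum => k _.
by rewrite ler_wpM2l// fg.
Qed.

Lemma seenD Q N a f g x :
  seen Q N a (fun y => f y + g y) x = seen Q N a f x + seen Q N a g x.
Proof.
rewrite /seen -mulrDr -big_split/=; congr (_ * _).
by apply: eq_bigr => k _; rewrite mulrDr.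
Qed.

Lemma seen_ge0 Q N a f x : (forall y, 0 <= f y) -> 0 <= seen Q N a f x.
Proof.
move=> f0; rewrite mulr_ge0 ?divr_ge0// sumr_ge0// => k _.
by rewrite mulr_ge0.
Qed.

(** The k with n_k = r mod Q are sorted by v = n_k mod P. For v in Lambda_P the pair (r, v) is a
    class of Lambda_{QP}, hence asymptotically of frequency above beta / |Lambda_{QP}|; the other v
    contribute nonnegative terms, which are dropped. *)
Lemma seen_limit a b c Q P (F : nat -> R) :
  modulus a b Q -> modulus b c P -> (a <= b)%N -> (b <= c)%N ->
  (forall x, 0 <= F x) -> has_period P F ->
  exists K, forall N, (K <= N)%N -> forall r x, res Q r ->
    beta * avg P (fun v => wgt P v * F (x + v)%N) <= seen Q N r F x.
Proof.
move=> mQ mP ab bc F0 FP.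
have mQP := modulus_mul ab bc mQ mP.
have [Q1 dQ] := modulus_good mQ; have [P1 dP] := modulus_good mP.
have [QP1 dQP] := modulus_good mQP.
have co := modulus_coprime mQ mP.
have [K KP] : exists K, forall N, (K <= N)%N -> forall v,
    (v < Q * P)%N -> res (Q * P) v ->
    N%:R * (beta / #|Lam (Q * P)%N|%:R) <=
      \sum_(k < N) (n k == v %[mod (Q * P)])%:R.
  have h v : exists K, forall N, (K <= N)%N -> res (Q * P) v ->
      N%:R * (beta / #|Lam (Q * P)%N|%:R) <=
        \sum_(k < N) (n k == v %[mod (Q * P)])%:R.
    have [rv|] := boolP (res (Q * P) v); last by exists 0%N.
    by have [K KP] := modulus_equidistributed mQP rv; exists K => N /KP.
  have [K KP] := choice h.
  (* Finitely many residues, so one threshold serves all of them, and hence all r and x. *)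
  exists (\max_(v < Q * P) K v)%N => N KN v vQP; apply: KP.
  apply: leq_trans KN.
  exact: (@leq_bigmax _ (fun v : 'I_(Q * P) => K v) (Ordinal vQP)).
exists (maxn K 1) => N; rewrite geq_max => /andP[KN N0] r x rQ.
pose w v := chinese Q P r v.
have wQ v : w v = r %[mod Q] by exact: chinese_modl.
have wP v : w v = v %[mod P] by exact: chinese_modr.
have NE : N%:R != 0 :> R by rewrite pnatr_eq0 -lt0n.
have cQ0 : 0 < #|Lam Q|%:R :> R by rewrite card_density// mulr_gt0// ltr0n ltnW.
have cP0 : 0 < #|Lam P|%:R :> R by rewrite card_density// mulr_gt0// ltr0n ltnW.
have cE : #|Lam (Q * P)%N|%:R = #|Lam Q|%:R * #|Lam P|%:R :> R.
  by rewrite !card_density// density_mul// natrM mulrACA.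
have -> : seen Q N r F x = #|Lam Q|%:R / N%:R *
    \sum_(v < P) (\sum_(k < N) (n k == w v %[mod (Q * P)])%:R) * F (x + v)%N.
  rewrite /seen; congr (_ * _).
  under [RHS]eq_bigr do rewrite mulr_suml.
  rewrite exchange_big/=; apply: eq_bigr => k _.
  under eq_bigr => v _.
    rewrite chinese_remainder// wQ wP -mulnb natrM -mulrA.
    over.
  rewrite -mulr_sumr; congr (_ * _).
  have P0 : (0 < P)%N by exact: ltnW.
  rewrite (bigD1 (Ordinal (ltn_pmod (n k) P0)))//= modn_mod eqxx mul1r.
  rewrite (has_period_modD _ _ FP) big1 ?addr0// => v vk.
  rewrite (modn_small (ltn_ord v)); case: eqP => [e|]; last by rewrite mul0r.
  by move: vk; rewrite -val_eqE/= e eqxx.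
rewrite /avg mulrA !mulr_sumr; apply: ler_sum => v _.
rewrite /wgt; have [rv|] := boolP (res P v); last first.
  by move=> _; rewrite !mul0r mulr0 !mulr_ge0 ?divr_ge0// sumr_ge0.
have rw : res (Q * P) (w v %% (Q * P)).
  rewrite (has_period_mod _ (@res_period Lam _ QP1)) res_mul//.
  rewrite -(has_period_mod _ (@res_period Lam _ Q1)) wQ.
  rewrite (has_period_mod _ (@res_period Lam _ Q1)) rQ.
  rewrite -(has_period_mod _ (@res_period Lam _ P1)) wP.
  by rewrite (has_period_mod _ (@res_period Lam _ P1)).
have vlt : (w v %% (Q * P) < Q * P)%N by rewrite ltn_pmod// ltnW.
have := KP N KN _ vlt rw; rewrite modn_mod cE => le1.
rewrite mul1r mulrA mulrA ler_wpM2r//.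
apply: le_trans (ler_wpM2l _ le1); last by rewrite divr_ge0.
rewrite le_eqVlt; apply/orP; left; apply/eqP.
rewrite /density; field.
by rewrite (gt_eqF cQ0) (gt_eqF cP0) NE /= pnatr_eq0 -lt0n ltnW.
Qed.

(** Every n_k = u mod t puts x + n_k into the slab. The factor |Lam t| in [concentrated] makes up
    for |Lam (Q t)| = |Lam Q| |Lam t| in the normalization of [seen]. *)
Lemma seen_concentrated Q t N a u g f x :
  (1 < Q)%N -> (1 < t)%N -> coprime Q t -> slab Lam t g (x + u)%N ->
  (forall y, 0 <= f y) -> 0 < density R (Lam t) ->
  seen (Q * t) N (chinese Q t a u) f x <=
  seen Q N a (concentrated Lam t g f) x.
Proof.
move=> Q1 t1 co su f0 dt; have Qt1 : (1 < Q * t)%N.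
  by rewrite (leq_trans Q1)// leq_pmulr// ltnW.
have cE : #|Lam (Q * t)%N|%:R = #|Lam Q|%:R * #|Lam t|%:R :> R.
  by rewrite !card_density// density_mul// natrM mulrACA.
rewrite /seen cE [_ * _ / _]mulrAC -[leLHS]mulrA ler_wpM2l ?divr_ge0//.
rewrite mulr_sumr.
apply: ler_sum => k _.
rewrite chinese_remainder// chinese_modl// chinese_modr//.
rewrite -mulnb natrM /concentrated.
have [e|_] := eqVneq (n k %% t)%N (u %% t)%N; last first.
  by rewrite mulr0 mul0r mulr0 !mulr_ge0.
have -> : slab Lam t g (x + n k).
  rewrite -(has_period_modD x (n k) (@slab_period R Lam t g)) e.
  by rewrite (has_period_modD x u (@slab_period R Lam t g)).
by rewrite mulr1 mul1r mulrCA.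
Qed.

(** * Attainable pairs and their combination *)

Variables (S : set nat) (alpha c : R).
Hypothesis n_incr : {homo n : i j / (i < j)%N}.
Hypothesis S_unbounded : forall K, exists2 N, S N & (K <= N)%N.
Hypothesis c_gt0 : 0 < c.
Hypothesis density_p_ge : forall j, c <= density R (Lam (p j)).
Hypothesis alpha_ge0 : 0 <= alpha.

(** The length N may depend on x but not on the class a. The upper bound L limits the averages to
    shifts below n L, which the next modulus can be made to exceed. *)
Definition sees (Q : nat) (f X : nat -> R) (M L : nat) := forall x, exists N,
  [/\ S N, (M <= N <= L)%N &
      forall a, res Q a -> beta * X x <= seen Q N a f x].

(* Requiring the lower bound along every residue class of an arbitrary earlier
   modulus Q, with averages longer than an arbitrary M, is what lets the
   construction be nested. *)
Definition attainable (m r : R) := forall (e : R) (h Q M : nat), 0 < e ->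
  modulus 0 h Q -> exists h' T (f X : nat -> R) L,
  [/\ (h <= h')%N, modulus h h' T,
      (forall x, 0 <= f x) /\ (forall x, 0 <= X x),
      has_period T f /\ has_period T X &
      [/\ avg T f = m + e, avg T (fun x => expR (- X x)) <= r + e &
          sees Q f X M L]].

Lemma attainable_cst m : 0 <= m -> attainable m 1.
Proof.
move=> m0 e h Q M e0 mQ; have [N SN MN] := S_unbounded M.
have Ph : (0 < p h)%N by exact: ltnW.
have me0 : 0 <= m + e by rewrite addr_ge0// ltW.
exists h.+1, (p h), (fun=> m + e), (fun=> 0), N; split=> //.
- exact: modulus_p.
- split; first by rewrite avg_cst.
    by rewrite avg_cst// oppr0 expR0 lerDl ltW.
  move=> x; exists N; split=> //; first by rewrite MN leqnn.
  by move=> a _; rewrite mulr0 seen_ge0.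
Qed.

(** Adding the constant d to f raises its mean and preserves the minorant. *)
Lemma attainable_widen m r d s : attainable m r -> 0 <= d -> r <= s ->
  attainable (m + d) s.
Proof.
move=> A d0 rs e h Q M e0 mQ.
have [h' [T [f [X [L [hh mT [f0 X0] [fT XT] [af aX sf]]]]]]] := A e h Q M e0 mQ.
have T0 : (0 < T)%N by exact: ltnW (modulus_gt1 mT).
exists h', T, (fun x => f x + d), X, L; split=> //.
- by split=> // x; rewrite addr_ge0.
- by split=> // x; rewrite fT.
- split.
  + by rewrite avgD af avg_cst// addrAC.
  + by rewrite (le_trans aX)// lerD2r.
  + move=> x; have [N [SN MN sN]] := sf x; exists N; split=> // a /sN le1.
    by rewrite (le_trans le1)// le_seen// => k _; rewrite lerDl.
Qed.

(** Pairwise coprime integers above 1 are distinct, so K + 1 of them cannot all be below K. *)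
Lemma p_unbounded h K : exists2 i, (h <= i)%N & (K <= p i)%N.
Proof.
apply: contrapT => no.
have lt i : (p (h + i) < K)%N.
  rewrite ltnNge; apply/negP => le; apply: no; exists (h + i)%N => //.
  exact: leq_addr.
pose F (i : 'I_K.+1) : 'I_K := Ordinal (lt i).
have : injective F.
  move=> i j /(congr1 val)/= e; apply: val_inj => /=.
  apply/eqP/negP => /negP ij.
  have := @p_coprime (h + i) (h + j); rewrite e /coprime gcdnn => H.
  have /H : (h + i <> h + j)%N by move=> /addnI/eqP; rewrite (negbTE ij).
  by apply/negP; rewrite gtn_eqF.
by move=> /leq_card; rewrite !card_ord ltnn.
Qed.

(** What the limit hypotheses provide at a fixed scale g, for arbitrarily late and sparse q_j. The
    third condition says that the intervals making up the thickening overlap little, g being the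
    largest possible density. *)
Definition good_scale (g eta : R) := forall h (e : R), 0 < e -> exists j,
  [/\ (h <= j)%N, density R (Lam (q j)) <= e,
      g * (1 - eta) <= density R (thicken g (Lam (q j))) &
      5 * alpha < #|far_pairs g (Lam (q j))|%:R / #|Lam (q j)|%:R ^+ 2].

(** At a visible x, some u in [Lam t] leads into the slab, and the class of (a, u) mod Q t sees
    [f1], while N >= K lets the hidden part add its share. At an inner invisible x, all x + n_k with
    k < L2 stay invisible and in one block, so [f2] is seen from the translated point. Elsewhere any
    admissible N does. *)
Lemma sees_combination Q t P T2 B W s g m M L1 L2 K c0 f1 f2 X1 X2 :
  (1 < Q)%N -> (1 < t)%N -> coprime Q t -> 0 < density R (Lam t) ->
  0 <= m -> 0 <= c0 -> (forall x, 0 <= f1 x) -> (forall x, 0 <= f2 x) ->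
  (forall x, 0 <= X1 x) ->
  (forall k, (k < L2)%N -> (n k <= W)%N) ->
  (forall N, (K <= N)%N -> forall a x, res Q a ->
     beta * (outside Lam t g x * far_mass Lam P T2 B s f2 x) <=
     seen Q N a (hidden Lam t P B s g f2) x) ->
  sees (Q * t) f1 X1 (maxn M K) L1 -> sees Q f2 X2 M L2 ->
  sees Q
    (fun x => hidden Lam t P B s g f2 x + concentrated Lam t g f1 x + c0)
    (gain Lam t P T2 B W s g alpha m f2 X1 X2) M (maxn L1 L2).
Proof.
move=> Q1 t1 co dt m0 c00 f10 f20 X10 nW hK s1 s2 x.
have hid0 y : 0 <= hidden Lam t P B s g f2 y by exact: hidden_ge0.
have con0 y : 0 <= concentrated Lam t g f1 y by exact: concentrated_ge0.
rewrite /gain; case: ifPn => [vx|nvx].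
  have [N [SN /andP[MN NL] sN]] := s1 x.
  move: MN; rewrite geq_max => /andP[MN KN].
  exists N; split=> //; first by rewrite MN leq_max NL.
  move=> a aQ; have /existsP[u /andP[ru su]] := vx.
  pose a' := chinese Q t a u.
  have ra' : res (Q * t) a'.
    rewrite res_mul//.
    rewrite -(has_period_mod _ (@res_period Lam Q Q1)) chinese_modl//.
    rewrite -(has_period_mod a' (@res_period Lam t t1)) chinese_modr//.
    by rewrite !has_period_mod ?aQ//; exact: res_period.
  apply: (@le_trans _ _ (seen Q N a (hidden Lam t P B s g f2) x +
                         seen Q N a (concentrated Lam t g f1) x)).
    rewrite mulrDr addrC lerD//.
      apply: le_trans (hK _ KN _ _ aQ); rewrite ler_wpM2l//; first exact: ltW.
      case: ifP => [/andP[ao mz]|_]; first by rewrite ler_pM.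
      by rewrite mulr_ge0 ?outside_ge0// far_mass_ge0.
    by apply: le_trans (sN _ ra') _; exact: seen_concentrated.
  by rewrite -seenD le_seen// => k _; rewrite lerDl.
case: ifPn => [/andP[nb ib]|_].
  have [N [SN /andP[MN NL] sN]] := s2 (shift P B s x).
  exists N; split=> //; first by rewrite MN leq_max NL orbT.
  move=> a aQ; apply: le_trans (sN a aQ) _; apply: le_seen => k kN.
  have kW : (n k <= W)%N by apply: nW; exact: leq_trans NL.
  apply: (@le_trans _ _ (hidden Lam t P B s g f2 (x + n k))); last first.
    by rewrite -addrA lerDl addr_ge0.
  rewrite /hidden /shift (inner_block_shift ib kW).
  move: nb; rewrite negb_exists => /forallP/(_ (Ordinal (kW : (n k < W.+1)%N))).
  by move=> /= ->; rewrite mul1r addnAC.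
have [N [SN /andP[MN NL] sN]] := s1 x.
move: MN; rewrite geq_max => /andP[MN KN].
exists N; split=> //; first by rewrite MN leq_max NL.
by move=> a _; rewrite mulr0 seen_ge0// => y; rewrite !addr_ge0.
Qed.

Lemma wgt_p_le j b : wgt (p j) b <= c^-1.
Proof.
rewrite /wgt; apply: (@le_trans _ _ (1 / density R (Lam (p j)))).
  by rewrite ler_wpM2r ?invr_ge0 ?density_ge0// lern1 leq_b1.
by rewrite mul1r lef_pV2 ?posrE.
Qed.

Lemma attainable_step m1 r1 m2 r2 g eta :
  attainable m1 r1 -> attainable m2 r2 -> 0 <= m1 -> 0 <= m2 ->
  0 < g <= 1 -> 0 <= eta <= 1 -> good_scale g eta ->
  attainable (g * m1 + (1 - g * (1 - eta)) * m2)
    (g * (1 - 4 * alpha * (1 - expR (- (alpha * m2)))) * r1 +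
     (1 - g * (1 - eta)) * r2).
Proof.
move=> A1 A2 m10 m20 /andP[g0 g1] /andP[eta0 eta1] good e h Q M e0 mQ.
(* One share for each of the five terms of [avg_exp_gain]. *)
pose e1 := e / 5; have e10 : 0 < e1 by rewrite divr_gt0.
have [h2 [T2 [f2 [X2 [L2 [hh2 mT2 [f20 X20] [f2P X2P]]]]]]] :=
  A2 e1 h Q M e10 mQ.
move=> [af2 aX2 s2].
(* An upper bound for every shift n_k used by the averages for [f2]. Next, t is taken so sparse that
   W times its density is at most e1, and B so long that block ends cost at most e1. *)
pose W := n L2.
have eW0 : 0 < e1 / W.+1%:R by rewrite divr_gt0.
have [j [h2j]] := good h2 _ eW0.
set t := q j => dt vt ft.
pose B := (Num.truncn (3 * W%:R / e1)).+1.
have BW : 3 * W%:R / B%:R <= e1.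
  rewrite ler_pdivrMr ?ltr0n// [e1 * _]mulrC -ler_pdivrMr//.
  by apply: ltW; exact: truncnS_gt.
(* [G] bounds the deviation of [smooth] from its mean, and c^-1 the weights modulo any p_i; [P0]
   then makes the variance bound at most e1 ^ 3. *)
pose G := T2%:R * (m2 + e1).
pose P0 := (Num.truncn (G ^+ 2 * (c^-1 * B%:R) / e1 ^+ 3)).+1.
have [i ji Pi] := p_unbounded j.+1 (maxn B P0).
set P := p i in Pi; move: Pi; rewrite geq_max => /andP[BP P0P].
have t1 : (1 < t)%N by exact: q_gt1.
have P1 : (1 < P)%N by exact: p_gt1.
have dt0 : 0 < density R (Lam t) by exact: density_q_gt0.
have dP0 : 0 < density R (Lam P) by exact: density_p_gt0.
have [T21 dT20] := modulus_good mT2.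
have Q1 := modulus_gt1 mQ.
have hi : (h2 <= i.+1)%N by rewrite (leq_trans h2j)// ltnW// ltnW.
have mt : modulus h2 j.+1 t by apply: modulus_widen (modulus_q j).
have mP : modulus j.+1 i.+1 P by apply: modulus_widen (modulus_p i).
have mth : modulus h i.+1 t.
  by apply: modulus_widen mt => //; rewrite ltnW// ltnS.
have cT2t : coprime T2 t by exact: modulus_coprime mT2 mt.
have cT2P : coprime T2 P.
  by apply: modulus_coprime mT2 (modulus_widen _ _ mP) => //; rewrite ltnW.
have ctP : coprime t P by exact: modulus_coprime mt mP.
have cPT2 : coprime P T2 by rewrite coprime_sym.
have ctPT2 : coprime t (P * T2) by rewrite coprimeMr ctP coprime_sym.
have cQt : coprime Q t by exact: modulus_coprime mQ mth.
have mPT : modulus h i.+1 (t * (P * T2))%N.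
  rewrite mulnA mulnC; apply: modulus_mul mT2 _ => //.
  by apply: modulus_mul mt mP; rewrite ?ltnS ?(leqW h2j) 1?ltnW.
have mQt : modulus 0 i.+1 (Q * t)%N.
  by apply: modulus_mul mQ mth => //; exact: leq_trans hi.
have P_gt0 : (0 < P)%N by exact: ltnW.
have T2_gt0 : (0 < T2)%N by exact: ltnW.
have [s sP] : exists s : nat -> nat, avg (P * T2) (fun x =>
    (far_mass Lam P T2 B s f2 x < m2)%R%:R) <= e1.
  have PG : G ^+ 2 * (c^-1 * B%:R / P%:R) <= e1 ^+ 3.
    rewrite mulrA ler_pdivrMr ?ltr0n// [e1 ^+ 3 * _]mulrC.
    rewrite -ler_pdivrMr ?exprn_gt0//.
    by apply: le_trans (ltW (truncnS_gt _)) _; rewrite ler_nat.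
  have af2' : avg T2 (smooth Lam T2 f2) = m2 + e1 by rewrite avg_smooth.
  have dev x : `|smooth Lam T2 f2 x - (m2 + e1)| <= G.
    by rewrite /G -af2; exact: smooth_dev.
  have PT0 : (0 < P * T2)%N by rewrite muln_gt0 P_gt0.
  have [s] := exists_good_shift P_gt0 (ltn0Sn _) T2_gt0
    (fun b => wgt_ge0 R Lam P b) (wgt_p_le i) (avg_wgt P1 dP0)
    (smooth_period Lam f2P) af2' dev PT0 e10 PG.
  by rewrite addrK => sP; exists s.
have [K hK] := @seen_limit 0 h i.+1 Q (t * (P * T2)) (hidden Lam t P B s g f2)
  mQ mPT (leq0n _) (leq_trans hh2 hi) (hidden_ge0 _ _ _ _ _ _ f20)
  (hidden_period _ _ _ _ _ _ f2P).
(* Chosen last: Q t counts as earlier modulus, and averages longer than K make the lower bound for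
   the hidden part valid at every N used for [f1]. *)
have [h' [T1 [f1 [X1 [L1 [hh1 mT1 [f10 X10] [f1P X1P]]]]]]] :=
  A1 e1 i.+1 (Q * t)%N (maxn M K) e10 mQt.
move=> [af1 aX1 s1].
have T11 := modulus_gt1 mT1.
have ctT1 : coprime t T1 by exact: modulus_coprime mth mT1.
pose T := (t * (P * T2) * T1)%N.
pose hid := hidden Lam t P B s g f2.
pose con := concentrated Lam t g f1.
pose gn := gain Lam t P T2 B W s g alpha m2 f2 X1 X2.
have T_modulus : modulus h h' T.
  by apply: modulus_mul mPT mT1 => //; exact: leq_trans hh2 hi.
set a := avg t (fun x => (visible Lam t g x)%:R) : R.
have ag' : g * (1 - eta) <= a by rewrite /a avg_visible.
have ag : a <= g by exact: avg_visible_le.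
have avgh : avg T hid = (1 - a) * (m2 + e1).
  by rewrite /T /hid avg_hidden// af2.
have avgc : avg T con <= g * (m1 + e1).
  by rewrite -af1; exact: avg_concentrated.
set kappa := 1 - expR (- (alpha * m2)).
have k0 : 0 <= kappa.
  by rewrite subr_ge0 -expR0 ler_expR oppr_le0 mulr_ge0.
have k1 : kappa <= 1 by rewrite gerBl expR_ge0.
have alpha5 : 5 * alpha < 1.
  exact: lt_le_trans ft (far_pairs_ratio_le1 _ _ _).
have avgg := avg_exp_gain W s t1 P1 T11 T21 dt0 cPT2 ctPT2 ctT1 g0 f2P X10 X1P
  X2P alpha_ge0 m20 (ltn0Sn _) BP (avg_visible_not_outside t1 g0 dt0 ft).
have Wd : W%:R * density R (Lam t) <= e1.
  apply: le_trans (ler_wpM2l (ler0n _ _) dt) _.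
  by rewrite mulrCA ler_piMr ?(ltW e10)// ler_pdivrMr ?ltr0n// mul1r ler_nat.
have eE : e = 5 * e1 by rewrite /e1 mulrCA divff ?mulr1.
pose m3 := g * m1 + (1 - g * (1 - eta)) * m2 + e.
(* A constant that brings the mean to exactly [m3]; it is nonnegative because the visible density is
   at least g (1 - eta). *)
pose c0 := m3 - avg T hid - avg T con.
have ge0 : 0 <= g * (1 - eta) by rewrite mulr_ge0 ?subr_ge0// ltW.
have c00 : 0 <= c0.
  have : (1 - a) * (m2 + e1) <= (1 - g * (1 - eta)) * (m2 + e1).
    by rewrite ler_wpM2r ?addr_ge0 ?(ltW e10)// lerB.
  have : g * e1 <= e1 by rewrite ler_piMl// ltW.
  have : 0 <= g * (1 - eta) * e1 by rewrite mulr_ge0// ltW.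
  rewrite /c0 /m3 avgh eE; nra.
exists h', T, (fun x => hid x + con x + c0), gn, (maxn L1 L2); split.
- by rewrite (leq_trans hh2)// (leq_trans hi).
- exact: T_modulus.
- split=> x; last exact: gain_ge0.
  apply: addr_ge0 c00; apply: addr_ge0; first exact: hidden_ge0.
  exact: concentrated_ge0.
- split; last exact: gain_period.
  move=> x; rewrite /T; congr (_ + _ + _).
    exact: (has_period_mulr _ (hidden_period _ _ _ _ _ _ f2P)).
  by rewrite /con mulnAC (has_period_mulr _ (concentrated_period _ _ _ f1P)).
split.
- have T0 : (0 < T)%N by exact: ltnW (modulus_gt1 T_modulus).
  have -> : avg T (fun x => hid x + con x + c0) = avg T hid + avg T con + c0.
    by rewrite avgD avgD avg_cst.
  by rewrite /c0 /m3; ring.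
- apply: le_trans avgg _; rewrite -/kappa -/a.
  set q1 := g * (1 - 4 * alpha * kappa).
  have ak : 4 * alpha * kappa <= 1 by nra.
  have ak0 : 0 <= 4 * alpha * kappa by rewrite !mulr_ge0.
  have q10 : 0 <= q1 by rewrite mulr_ge0 ?(ltW g0)// subr_ge0.
  have q11 : q1 <= 1 by rewrite mulr_ile1 ?(ltW g0)// ?subr_ge0// gerBl.
  have h1 := ler_wpM2l q10 aX1.
  have h2' : (1 - a) * avg T2 (fun x => expR (- X2 x)) <=
             (1 - g * (1 - eta)) * (r2 + e1).
    apply: ler_pM => //; [by lra|by apply: avg_ge0 => x; exact: expR_ge0|].
    by rewrite lerB.
  have h3 : q1 * e1 <= e1 by rewrite ler_piMl// ltW.
  have h4 : 0 <= g * (1 - eta) * e1 by rewrite mulr_ge0// ltW.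
  apply: le_trans (lerD (lerD (lerD (lerD h1 sP) h2') Wd) BW) _.
  rewrite eE mulrDr [(1 - _) * (r2 + _)]mulrDr [(1 - _) * e1]mulrBl mul1r.
  lra.
- apply: sees_combination s2 => //.
  + by move=> k kL; apply/ltnW/n_incr.
  + by move=> N KN a' x aQ; rewrite -avg_wgt_hidden//; exact: hK.
Qed.

(** * Iteration of the combination *)

Hypothesis alpha_gt0 : 0 < alpha.
Hypothesis alpha_le1 : alpha <= 1.
Hypothesis small_scales : forall eta : R, 0 < eta ->
  exists2 g0, 0 < g0 & forall g, 0 < g < g0 -> good_scale g eta.

Lemma half_le_one_sub_exp (y : R) : 0 <= y <= 1 -> y / 2 <= 1 - expR (- y).
Proof.
move=> /andP[y0 y1]; have y10 : 0 < 1 + y by lra.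
suff : expR (- y) <= 1 - y / 2 by lra.
rewrite expRN; apply: (@le_trans _ _ (1 + y)^-1).
  by rewrite lef_pV2 ?posrE ?expR_gt0// expR_ge1Dx.
rewrite -[leLHS]mul1r ler_pdivrMr//; nra.
Qed.

Lemma exp_le_one_sub (y : R) : 0 <= y <= 2^-1 -> expR (- (2 * y)) <= 1 - y.
Proof.
move=> /andP[y0 y1]; rewrite expRN -[leLHS]mul1r ler_pdivrMr ?expR_gt0//.
have h : 1 + 2 * y <= expR (2 * y) by exact: expR_ge1Dx.
have y10 : 0 <= 1 - y by lra.
apply: le_trans (ler_wpM2l y10 h); nra.
Qed.

(* k applications of [attainable_step] starting from (m + 1, r); the terms in
   eta are the accumulated errors. *)
Lemma attainable_iterate m r g eta k :
  attainable m r -> 0 <= m -> 0 <= r -> 0 < g <= 1 -> 0 <= eta <= 1 ->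
  good_scale g eta -> k%:R * g * eta * (m + 2) <= 1 ->
  attainable (m + ((1 - g) ^+ k + k%:R * g * eta * (m + 2)))
    (r * (1 - (k%:R * g * (2 * alpha ^+ 2) * (1 - g) ^+ k -
               2 * (k%:R * g * eta)))).
Proof.
move=> A m0 r0 /andP[g0 g1] eta01 good; have /andP[eta0 eta1] := eta01.
elim: k => [|k IH] small.
  rewrite expr0 !mul0r mulr0 subr0 subr0 addr0 mulr1.
  exact: attainable_widen A ler01 (lexx r).
have ge0 : 0 <= g * eta by rewrite mulr_ge0// ltW.
have gem0 : 0 <= g * eta * (m + 2) by rewrite mulr_ge0// addr_ge0.
have small' : k%:R * g * eta * (m + 2) <= 1.
  apply: le_trans small.
  have -> : k.+1%:R * g * eta * (m + 2) =
      k%:R * g * eta * (m + 2) + g * eta * (m + 2) by rewrite -natr1; ring.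
  by rewrite lerDl.
have {}IH := IH small'.
move: IH; set x := (1 - g) ^+ k; set z := k%:R * g * eta * (m + 2).
have x0 : 0 <= x by rewrite exprn_ge0// subr_ge0.
have x1 : x <= 1 by rewrite exprn_ile1// ?subr_ge0// gerBl ltW.
have z1 : z <= 1 by exact: small'.
have z0 : 0 <= z by rewrite /z -!mulrA mulr_ge0// mulrA.
move=> IH.
have m20 : 0 <= m + (x + z) by rewrite !addr_ge0.
have g01 : 0 < g <= 1 by rewrite g0.
have step := attainable_step A IH m0 m20 g01 eta01 good.
set m3 := (X in attainable X _) in step.
set m4 := (X in attainable X _).
have m34 : m3 <= m4.
  suff : 0 <= m4 - m3 by rewrite subr_ge0.
  have -> : m4 - m3 = g * z + g * eta * (2 - (x + z)).
    by rewrite /m4 /m3 exprS -/x /z -natr1; ring.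
  have xz : 0 <= 2 - (x + z) by lra.
  by apply: addr_ge0; apply: mulr_ge0 => //; exact: ltW.
rewrite -(subrK m3 m4) addrC.
apply: attainable_widen step _ _; first by rewrite subr_ge0.
set kappa := 1 - expR (- (alpha * (m + (x + z)))).
(* Of the mean m + x + z only the part x <= 1 is used, where 1 - exp (- y) is at least y / 2; this
   turns 4 alpha kappa into 2 alpha^2 x. *)
have kx : alpha * x / 2 <= kappa.
  apply: (@le_trans _ _ (1 - expR (- (alpha * x)))).
    apply: half_le_one_sub_exp; rewrite mulr_ge0//=.
    by rewrite mulr_ile1// ltW.
  rewrite /kappa lerD2l lerN2 ler_expR lerN2 ler_wpM2l//.
  by rewrite addrCA lerDl addr_ge0.
rewrite [X in X + _]mulrC [X in _ + X]mulrCA -mulrDr ler_wpM2l//.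
set u := k%:R * g * eta; set v := k%:R * g * (2 * alpha ^+ 2).
have u0 : 0 <= u by rewrite /u -mulrA mulr_ge0.
have u1 : 2 * u <= 1.
  apply: le_trans small'; rewrite mulrC -/u ler_wpM2l// lerDr//.
have v0 : 0 <= v by rewrite !mulr_ge0// ?sqr_ge0// ltW.
have -> : k.+1%:R * g * (2 * alpha ^+ 2) * (1 - g) ^+ k.+1 -
    2 * (k.+1%:R * g * eta) =
    (v + g * (2 * alpha ^+ 2)) * ((1 - g) * x) - 2 * (u + g * eta).
  by rewrite (exprS (1 - g) k) -/x /u /v -natr1; ring.
have kxg : g * (2 * alpha ^+ 2) * x <= g * (4 * alpha * kappa).
  rewrite -mulrA ler_wpM2l// ?(ltW g0)//.
  have a4 : 0 <= 4 * alpha by rewrite mulr_ge0.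
  by apply: le_trans (ler_wpM2l a4 kx); nra.
have xg : (1 - g) * x <= x by rewrite ler_piMl// gerBl ltW.
have c00 : 0 <= g * (2 * alpha ^+ 2) by rewrite !mulr_ge0 ?sqr_ge0// ltW.
have h1 := ler_wpM2l c00 xg.
have h2 : 0 <= g * eta * (v * x) by apply: mulr_ge0 => //; exact: mulr_ge0.
have h3 : 0 <= g * eta * (1 - 2 * u) by apply: mulr_ge0 => //; rewrite subr_ge0.
have h4 : 0 <= g * u by rewrite mulr_ge0// ltW.
lra.
Qed.

(** It matters that D depends on K only, not on m or r: repeated rounds then reach any mean. With x
    = (1 - g) ^ (M / g), the increase d is at most 2 x, while r is multiplied by at most 1 - M c0 x
    / 2 <= 1 - 2 K x <= exp (- K d). *)
Lemma attainable_round (K : R) : 0 < K -> exists2 D, 0 < D &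
  forall m r, attainable m r -> 0 <= m -> 0 <= r ->
  exists2 d, D <= d & attainable (m + d) (r * expR (- (K * d))).
Proof.
move=> K0; pose c0 := 2 * alpha ^+ 2.
have c00 : 0 < c0 by rewrite mulr_gt0// exprn_gt0.
pose M := (Num.truncn (4 * K / c0)).+1.
have MK : 4 * K <= M%:R * c0.
  by rewrite -ler_pdivrMr// ltW// truncnS_gt.
have M0 : 0 < M%:R :> R by rewrite ltr0n.
(* A lower bound for (1 - g) ^ (M / g), from 1 - g >= exp (- 2 g) for g <= 1 / 2. *)
exists (expR (- (2 * M%:R))) => [|m r A m0 r0]; first exact: expR_gt0.
set D := expR _; have D0 : 0 < D by exact: expR_gt0.
have D1 : D <= 1 by rewrite /D -expR0 ler_expR oppr_le0 mulr_ge0.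
have m20 : 0 < m + 2 by lra.
(* The first bound keeps the error in the mean below D <= x, so that d <= 2 x; the last keeps the
   error 2 M eta in the factor below half of M c0 x. *)
pose eta := Num.min (D / (M%:R * (m + 2))) (Num.min 1 (c0 * D / 4)).
have eta0 : 0 < eta.
  by rewrite !lt_min ltr01 !divr_gt0 ?mulr_gt0.
have eta1 : eta <= 1 by rewrite /eta !ge_min lexx orbT.
have etaD : M%:R * eta * (m + 2) <= D.
  rewrite mulrAC mulrC -ler_pdivlMr ?mulr_gt0// ge_min lexx//.
have etac : 4 * eta <= c0 * D.
  by rewrite mulrC -ler_pdivlMr// /eta !ge_min lexx !orbT.
have [g0 g00 good] := small_scales eta0.
pose N0 := (maxn 2 (Num.truncn g0^-1).+1).
have N02 : (2 <= N0)%N by exact: leq_maxl.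
have N00 : 0 < N0%:R :> R by rewrite ltr0n; exact: leq_trans N02.
(* The inverse of an integer, so that M / g is the integer number of steps M N0. *)
pose g : R := N0%:R^-1.
have gg0 : 0 < g by rewrite invr_gt0.
have gh : g <= 2^-1 by rewrite lef_pV2 ?posrE// ler_nat.
have glt : g < g0.
  rewrite -[ltRHS]invrK ltf_pV2 ?posrE ?invr_gt0//.
  by apply: lt_le_trans (truncnS_gt _) _; rewrite ler_nat leq_maxr.
have Mg : (M * N0)%:R * g = M%:R by rewrite natrM -mulrA divff ?mulr1 ?gt_eqF.
have := @attainable_iterate m r g eta (M * N0) A m0 r0.
rewrite Mg => /(_ _ _ _ _)/wrap[].
- by rewrite gg0; lra.
- by rewrite eta1 ltW.
- by apply: good; rewrite gg0 glt.
- exact: le_trans etaD D1.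
set x := (1 - g) ^+ (M * N0) => Ar.
have xD : D <= x.
  have -> : D = expR (- (2 * g)) ^+ (M * N0).
    rewrite -expRM_natl /D; congr expR.
    by rewrite mulrN mulrCA Mg.
  rewrite lerXn2r ?nnegrE ?expR_ge0//; first by lra.
  by apply: exp_le_one_sub; rewrite gh ltW.
exists (x + M%:R * eta * (m + 2)).
  by rewrite (le_trans xD)// lerDl !mulr_ge0// ltW.
rewrite -[_ + (x + _)]addr0; apply: attainable_widen Ar _ _ => //.
rewrite ler_wpM2l//; set phi := (X in 1 - X).
apply: le_trans (expR_ge1Dx _) _; rewrite ler_expR lerN2.
have xc : c0 * D <= c0 * x by rewrite ler_wpM2l// ltW.
have h1 : M%:R * (4 * eta) <= M%:R * (c0 * x).
  by rewrite ler_wpM2l ?(ltW M0)//; exact: le_trans xc.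
have h2 : K * (x + M%:R * eta * (m + 2)) <= K * (2 * x).
  by rewrite ler_wpM2l ?(ltW K0)//; lra.
have h3 : 4 * K * x <= M%:R * c0 * x.
  by rewrite ler_wpM2r//; lra.
rewrite /phi -/c0; lra.
Qed.

Lemma attainable_large (K m0 : R) : 0 < K ->
  exists2 m, m0 <= m & attainable m (expR (- (K * m))).
Proof.
move=> K0; have [D D0 round] := attainable_round K0.
suff h k : exists2 m, k%:R * D <= m & attainable m (expR (- (K * m))).
  have [m mk A] := h (Num.truncn (m0 / D)).+1; exists m => //.
  by apply: le_trans mk; rewrite -ler_pdivrMr// ltW// truncnS_gt.
elim: k => [|k [m km A]].
  exists 0; first by rewrite mul0r.
  by rewrite mulr0 oppr0 expR0; exact: attainable_cst.
have m_ge0 : 0 <= m by apply: le_trans km; rewrite mulr_ge0// ltW.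
have [d Dd Ad] := round _ _ A m_ge0 (expR_ge0 _).
exists (m + d); first by rewrite -natr1 mulrDl mul1r lerD.
by rewrite mulrDr opprD expRD.
Qed.

(** * From attainable pairs to the failure of the weak-type bound *)

Lemma average_ge_seen Q N f X x : (1 < Q)%N -> 0 < density R (Lam Q) ->
  (forall y, 0 <= f y) -> (forall a, res Q a -> X <= seen Q N a f x) ->
  X <= N%:R^-1 * \sum_(k < N) f (x + n k)%N.
Proof.
move=> Q1 dQ f0 h.
have c0' : 0 < #|Lam Q|%:R :> R.
  by rewrite card_density// mulr_gt0// ltr0n ltnW.
rewrite -(ler_pM2l c0').
(* Summing over a in Lambda_Q: each n_k lies in only one class, so the sum of the [seen] averages is
   at most |Lambda_Q| times the plain average. *)
apply: (@le_trans _ _ (\sum_(a < Q) (res Q a)%:R * seen Q N a f x)).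
  rewrite (card_res R Lam Q1) mulr_suml; apply: ler_sum => a _.
  by have [ra|] := boolP (res Q a); rewrite ?mul0r// ler_wpM2l// h.
rewrite /seen mulrA; under eq_bigr do rewrite mulrCA.
rewrite -mulr_sumr ler_wpM2l ?divr_ge0//.
under eq_bigr do rewrite mulr_sumr.
rewrite exchange_big/=; apply: ler_sum => k _.
have Q0 : (0 < Q)%N by exact: ltnW.
rewrite (bigD1 (Ordinal (ltn_pmod (n k) Q0)))//= modn_mod eqxx mul1r.
rewrite big1 ?addr0 => [|a ak]; first by rewrite ler_piMl// lern1 leq_b1.
case: eqP => [e|_]; last by rewrite mul0r mulr0.
by move: ak; rewrite -val_eqE/= e modn_small ?eqxx.
Qed.

Lemma weak_type_unbounded (C : R) : 0 < C ->
  exists (d : measure_display) (X : measurableType d) (mu : probability X R)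
         (tau : X -> X) (f : X -> R),
    [/\ measure_preserving mu tau,
        mu.-integrable [set: X] (EFin \o f) &
        (C%:E * 'N[mu]_1[EFin \o f] <
         weak_norm1 mu (maximal_along n S tau f))%E].
Proof.
(* Chosen so that the level l = 2 C (m + e) below satisfies l / beta <= L m as soon as e <= 1 <=
   m. *)
move=> C0; pose L := 4 * C / beta.
have L0 : 0 < L by rewrite divr_gt0// mulr_gt0.
have K0 : 0 < L + 2 by rewrite addr_gt0.
(* The exponent L + 2 exceeds L by 2: Chebyshev's inequality costs exp (L m) and leaves exp (- 2 m)
   <= 1 / 3. The choice of e adds at most 1 / 12, so the bad set has density below 1 / 2. *)
have [m m1 A] := attainable_large 1 K0.
have m0 : 0 < m by exact: lt_le_trans m1.
pose e := Num.min 1 (expR (- (L * m)) / 12) : R.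
have e0 : 0 < e by rewrite lt_min ltr01 divr_gt0// expR_gt0.
have e1 : e <= 1 by rewrite ge_min lexx.
have eL : e <= expR (- (L * m)) / 12 by rewrite /e ge_min lexx orbT.
have m0p : modulus 0 1 (p 0) by exact: modulus_p.
have [h' [T [f [X [B [hh mT [f0 X0] [fT XT] [af aX sf]]]]]]] :=
  A e 1%N (p 0) 1%N e0 m0p.
have T0 : (0 < T)%N by exact: ltnW (modulus_gt1 mT).
pose l := 2 * C * (m + e).
have me0 : 0 < m + e by rewrite addr_gt0.
have l0 : 0 < l by rewrite !mulr_gt0.
pose bad x : R := (beta * X x <= l)%R%:R.
have avg_bad : avg T bad < 2^-1.
  have lb : l / beta <= L * m.
    have -> : L * m = (4 * C * m) / beta by rewrite /L mulrAC.
    rewrite ler_pM2r ?invr_gt0// /l; nra.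
  have le1 : avg T bad <= expR (L * m) * avg T (fun x => expR (- X x)).
    rewrite -avgZ; apply: le_avg => x _; rewrite /bad -expRD.
    have [Xl|_] := leP (beta * X x) l; last exact: expR_ge0.
    rewrite -[true%:R]expR0 ler_expR subr_ge0; apply: le_trans lb.
    by rewrite ler_pdivlMr// mulrC.
  apply: le_lt_trans le1 _.
  apply: le_lt_trans (ler_wpM2l (expR_ge0 _) aX) _.
  rewrite mulrDr -expRD.
  have -> : L * m - (L + 2) * m = - (2 * m) by ring.
  have h1 : expR (L * m) * e <= 12^-1.
    apply: le_trans (ler_wpM2l (expR_ge0 _) eL) _.
    by rewrite mulrA expRxMexpNx_1 mul1r.
  have h2 : expR (- (2 * m)) <= 3^-1.
    rewrite expRN lef_pV2 ?posrE ?expR_gt0//.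
    by apply: le_trans (expR_ge1Dx _); lra.
  lra.
case: T T0 mT fT XT af aX avg_bad => // T' T0 mT fT XT af aX avg_bad.
pose good : set nat := [set x | l < beta * X x].
apply: (@weak_type_failure R T' n S f C l good) => //.
  move=> x gx; have [N [SN NB sN]] := sf x; exists N => //.
  apply: lt_le_trans gx _.
  apply: (average_ge_seen (Q := p 0)) sN => //.
have -> : avg T'.+1 (\1_good : nat -> R) = 1 - avg T'.+1 bad.
  apply/eqP; rewrite eq_sym subr_eq -avgD; apply/eqP.
  rewrite -[LHS](@avg_cst _ T'.+1)//; apply: eq_avg => x _.
  rewrite indicE /bad leNgt.
  have -> : (x \in good) = (l < beta * X x) by apply/idP/idP; rewrite inE.
  by case: (l < _) => /=; rewrite ?addr0 ?add0r.
(* The good set has density above 1 / 2, which is exactly what the factor 2 in l requires. *)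
have -> : C * avg T'.+1 f = l / 2 by rewrite af /l; field.
by rewrite ltr_pM2l//; lra.
Qed.

End Moduli.

(** * Deduction of the theorem from its limit hypotheses *)

Theorem theorem3p1 (R : realType) (n : nat -> nat) (alpha beta : R)
    (Lam : forall t : nat, {set 'Z_t}) (p q : nat -> nat)
    (n_incr : {homo n : i j / (i < j)%N})
    (alpha_gt0 : 0 < alpha) (beta_gt0 : 0 < beta)
    (Lam_sub : forall t : nat, (1 < t)%N ->
       forall a : 'Z_t, a \in Lam t -> exists k : nat, a = (n k)%:R)
    (Lam_coprime : forall s t : nat, (1 < s)%N -> (1 < t)%N -> coprime s t ->
       periodic (Lam (s * t)%N) = periodic (Lam s) `&` periodic (Lam t))
    (p_gt1 : forall j, (1 < p j)%N) (q_gt1 : forall j, (1 < q j)%N)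
    (p_coprime : forall i j, i <> j -> coprime (p i) (p j))
    (q_coprime : forall i j, i <> j -> coprime (q i) (q j))
    (pq_coprime : forall i j, coprime (p i) (q j))
    (Lam_q_neq0 : forall j, Lam (q j) != finset.set0)
    (density_q : density R (Lam (q j)) @[j --> \oo] --> (0 : R))
    (density_p : 0 < inf [set density R (Lam (p j)) | j in [set: nat]])
    (density_thicken :
       (fun g : R => g - limn_inf (fun j => density R (thicken g (Lam (q j)))))
       =o_ (0^'+) (fun g : R => g))
    (far_pairs_q : \forall g \near (0 : R)^'+,
       5 * alpha <
       limn_inf (fun j => #|far_pairs g (Lam (q j))|%:R
                          / #|Lam (q j)|%:R ^+ 2))
    (equidistribution : forall I J : seq nat,
       sorted ltn I -> sorted ltn J -> I <> [::] \/ J <> [::] ->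
       let Q := (\prod_(i <- I) p i * \prod_(j <- J) q j)%N in
       forall a : 'Z_Q, a \in Lam Q ->
       beta / #|Lam Q|%:R <
       limn_inf (fun N : nat =>
         N%:R^-1 * #|[set k : 'I_N | (n k)%:R == a]%SET|%:R))
    (C : R) (C_gt0 : 0 < C)
    (S : set nat) (S_pos : forall N, S N -> (0 < N)%N)
    (S_infinite : infinite_set S) :
  exists (d : measure_display) (X : measurableType d) (mu : probability X R)
         (tau : X -> X) (f : X -> R),
    [/\ measure_preserving mu tau,
        mu.-integrable [set: X] (EFin \o f) &
        (C%:E * 'N[mu]_1[EFin \o f] <
         weak_norm1 mu (maximal_along n S tau f))%E].
Proof.
set c := inf _ in density_p.
have density_p_ge j : c <= density R (Lam (p j)).
  apply: ge_inf; last by exists j.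
  by exists 0 => _ [i _ <-]; exact: density_ge0.
have density_p_gt0 j : 0 < density R (Lam (p j)).
  exact: lt_le_trans density_p (density_p_ge j).
have density_q_gt0 j : 0 < density R (Lam (q j)).
  rewrite divr_gt0// ltr0n; last exact: ltnW.
  by rewrite card_gt0.
have S_unbounded K : exists2 N, S N & (K <= N)%N.
  apply: contrapT => no; apply: S_infinite.
  apply: sub_finite_set (finite_II K) => N SN /=.
  by rewrite ltnNge; apply/negP => KN; apply: no; exists N.
have ratio01 (g : R) j :
    0 <= (#|far_pairs g (Lam (q j))|%:R / #|Lam (q j)|%:R ^+ 2 : R) <= 1.
  apply/andP; split; first by rewrite divr_ge0.
  exact: far_pairs_ratio_le1.
have near0 (P : R -> Prop) : (\forall g \near (0 : R)^'+, P g) ->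
    exists2 g0, 0 < g0 & forall g, 0 < g < g0 -> P g.
  move=> [e /= e0 eP]; exists e => // g /andP[g0 ge].
  by apply: eP => //=; rewrite sub0r normrN gtr0_norm.
have [g1 g10 far] := near0 _ far_pairs_q.
(* A ratio of far pairs to all pairs is at most 1 and, at a small scale, exceeds 5 alpha for large
   j. *)
have alpha_le1 : alpha <= 1.
  have gh : 0 < g1 / 2 < g1 by rewrite divr_gt0//= ltr_pdivrMr//; lra.
  have [K /(_ K (leqnn K))] :=
    @limn_inf_gt _ _ 0 1 _ (fun j => ratio01 _ j) (far _ gh).
  have /andP[_ le1] := ratio01 (g1 / 2) K.
  move=> /lt_le_trans/(_ le1); lra.
have small_scales (eta : R) : 0 < eta -> exists2 g0, 0 < g0 &
    forall g, 0 < g < g0 -> good_scale Lam q alpha g eta.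
  move=> eta0; have eta20 : 0 < eta / 2 by rewrite divr_gt0.
  have /near0[g2 g20 thick] := (eqoP _ _ _).1 density_thicken _ eta20.
  exists (Num.min g1 g2) => [|g]; first by rewrite lt_min g10.
  rewrite lt_min => /and3P[g0 gg1 gg2] h e e0.
  have gg1' : 0 < g < g1 by rewrite g0.
  have gg2' : 0 < g < g2 by rewrite g0.
  have [K1 farK] :=
    @limn_inf_gt _ _ 0 1 _ (fun j => ratio01 _ j) (far _ gg1').
  have thick01 j : 0 <= density R (thicken g (Lam (q j))) <= 1.
    by rewrite density_ge0 density_le1.
  (* The little-o bound with eta / 2 gives a lower limit of at least g (1 - eta / 2); the slack
     makes the inequality strict, as needed to pass to individual j. *)
  have thick_lt : g * (1 - eta) <
      limn_inf (fun j => density R (thicken g (Lam (q j)))).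
    have := thick _ gg2'; rewrite (gtr0_norm g0) => /ler_normlW; nra.
  have [K2 thickK] := @limn_inf_gt _ _ 0 1 _ thick01 thick_lt.
  have [K3 _ densK] := (cvgrPdist_le _ _).1 density_q _ e0.
  pose j := maxn h (maxn K1 (maxn K2 K3)).
  exists j; split.
  - exact: leq_maxl.
  - have := densK j; rewrite /= sub0r normrN ger0_norm ?density_ge0//; apply.
    by rewrite /j !leq_max leqnn !orbT.
  - by apply/ltW/thickK; rewrite /j !leq_max leqnn !orbT.
  - by apply: farK; rewrite /j !leq_max leqnn !orbT.
exact: (weak_type_unbounded Lam_coprime p_gt1 q_gt1 p_coprime q_coprime
  pq_coprime density_p_gt0 density_q_gt0 beta_gt0 equidistribution
  n_incr S_unbounded density_p density_p_ge (ltW alpha_gt0) alpha_gt0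
  alpha_le1 small_scales C_gt0).
Qed.
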